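(* Suppose $p_{XY}$ has full support on $\mathcal{X}\times\mathcal{Y}$ and $(p_{XY},p_{Z|XY})$ is computable with asymptotic security. Then (the conditions of the characterization hold, so classes can be indexed consistently across $y$ as described in the context, and) \[R_S=H(W|Y),\] where $(X,Y,Z)\sim p_{XY}p_{Z|XY}$ and $W\in[k]$ is the random variable defined by $W=i$ iff $Z\in\mathcal{Z}_i^{(Y)}$.
   Context: Setup: $\mathcal{X},\mathcal{Y},\mathcal{Z}$ finite; Alice observes $X^n$, Bob observes $Y^n$, $(X_i,Y_i)$ i.i.d. $\sim p_{XY}$; target output p.m.f. $\prod_i p_{Z|XY}(z_i|x_i,y_i)$, giving $p_{X^nY^nZ^n}$. An $(n,2^{nR})$-code is a pair of stochastic maps $(p_{M|X^n},p_{\hat Z^n|MY^n})$, $M\in\{1,\dots,2^{nR}\}$. $\|p-q\|_1=\frac12\sum|p-q|$. Rate $R$ is achievable if there is a sequence of rate-$R$ codes such that for every $\epsilon>0$ there is a large enough $n$ with $\|p_{X^nY^n\hat Z^n}-p_{X^nY^nZ^n}\|_1\le\epsilon$ and $I(M;X^n|Y^n,\hat Z^n)\le n\epsilon$; $R_S$ is the infimum of achievable rates, and computability with asymptotic security means $R_S<\infty$. For $y\in\mathcal{Y}$ let $\mathcal{Z}^{(y)}=\{z:\exists x,\ p_{Z|XY}(z|x,y)>0\}$; partition $\mathcal{Z}^{(y)}$ into the classes $\mathcal{Z}_1^{(y)},\dots,\mathcal{Z}_{k(y)}^{(y)}$ of the equivalence relation ''$z\equiv_y z'$ iff the columns $(p_{Z|XY}(z|x,y))_x$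 and $(p_{Z|XY}(z'|x,y))_x$ are positive scalar multiples''; each class has an associated probability vector $\vec\alpha_i^{(y)}$ on $\mathcal{X}$ with $p_{Z|XY}(z|x,y)=\vec\alpha_i^{(y)}(x)\vec\gamma_i^{(y)}(z)$ for $z\in\mathcal{Z}_i^{(y)}$. Under the hypotheses, $k(y)=k$ for all $y$ and the classes can be indexed so that $\vec\alpha_i^{(y)}$ does not depend on $y$; $W$ is defined with this indexing. *)

(* Defs.v *)
From Stdlib Require Import Reals ClassicalEpsilon.
From mathcomp Require Import all_boot.

Set Implicit Arguments.
Unset Strict Implicit.
Unset Printing Implicit Defensive.

Local Open Scope R_scope.

Definition sumR {T : finType} (f : T -> R) : R := \big[Rplus/0]_(t : T) f t.
Definition prodn (n : nat) (f : 'I_n -> R) : R := \big[Rmult/1]_(i < n) f i.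

Definition log2 (x : R) : R := ln x / ln 2.

Definition is_pmf {T : finType} (p : T -> R) : Prop :=
  (forall t, 0 <= p t) /\ sumR p = 1.

Definition seqn (T : finType) (n : nat) := {ffun 'I_n -> T}.

Section Model.
Variables (X Y Z : finType) (pXY : X -> Y -> R) (pZ : X -> Y -> Z -> R).

Definition pXYn (n : nat) (x : seqn X n) (y : seqn Y n) : R :=
  prodn (fun i => pXY (x i) (y i)).

Definition pXYZn (n : nat) (x : seqn X n) (y : seqn Y n) (z : seqn Z n) : R :=
  prodn (fun i => pXY (x i) (y i) * pZ (x i) (y i) (z i)).

Record code (n m : nat) := Code {
  enc : seqn X n -> 'I_m -> R;
  dec : 'I_m -> seqn Y n -> seqn Z n -> R }.

Definition valid_code n m (c : code n m) : Prop :=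
  (forall x, is_pmf (enc c x)) /\ (forall mm y, is_pmf (dec c mm y)).

Definition joint n m (c : code n m) x y mm z : R :=
  pXYn x y * enc c x mm * dec c mm y z.

Definition joint_XYZ n m (c : code n m) x y z : R :=
  sumR (fun mm => joint c x y mm z).

Definition tv_dist n m (c : code n m) : R :=
  / 2 * sumR (fun x : seqn X n => sumR (fun y : seqn Y n => sumR (fun z : seqn Z n =>
      Rabs (joint_XYZ c x y z - pXYZn x y z)))).

End Model.

Definition cmi {A B C : finType} (P : A -> B -> C -> R) : R :=
  let Pc  := fun c => sumR (fun a => sumR (fun b => P a b c)) in
  let Pac := fun a c => sumR (fun b => P a b c) in
  let Pbc := fun b c => sumR (fun a => P a b c) in
  sumR (fun a => sumR (fun b => sumR (fun c =>
    if Req_EM_T (P a b c) 0 then 0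
    else P a b c * log2 (P a b c * Pc c / (Pac a c * Pbc b c))))).

Section Rate.
Variables (X Y Z : finType) (pXY : X -> Y -> R) (pZ : X -> Y -> Z -> R).

Definition leak n m (c : code X Y Z n m) : R :=
  cmi (fun (mm : 'I_m) (x : seqn X n) (yz : (seqn Y n * seqn Z n)%type) =>
         joint pXY c x yz.1 mm yz.2).

Definition achievable (Rt : R) : Prop :=
  exists (msz : nat -> nat) (c : forall n, code X Y Z n (msz n)),
    (forall n, INR (msz n) <= Rpower 2 (INR n * Rt) /\ valid_code (c n)) /\
    forall eps, 0 < eps -> exists N : nat, forall n : nat, (N <= n)%N ->
      tv_dist pXY pZ (c n) <= eps /\ leak (c n) <= INR n * eps.

Definition is_inf (S : R -> Prop) (r : R) : Prop :=
  (forall s, S s -> r <= s) /\ (forall r', (forall s, S s -> r' <= s) -> r' <= r).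

Definition inZy (y : Y) (z : Z) : Prop := exists x, 0 < pZ x y z.

Definition equiv_y (y : Y) (z z' : Z) : Prop :=
  exists c, 0 < c /\ forall x, pZ x y z = c * pZ x y z'.

(* the conditions of the characterization: k(y) = k for all y and the classes
   can be indexed so that alpha_i does not depend on y *)
Definition consistent_classes : Prop :=
  exists (k : nat) (alpha : 'I_k -> X -> R),
    (forall i, is_pmf (alpha i)) /\
    forall y,
      (forall z, inZy y z -> exists! i : 'I_k,
          exists c, 0 < c /\ forall x, pZ x y z = c * alpha i x) /\
      (forall i : 'I_k, exists z, inZy y z /\
          exists c, 0 < c /\ forall x, pZ x y z = c * alpha i x).

Definition pYZ (y : Y) (z : Z) : R := sumR (fun x => pXY x y * pZ x y z).
Definition pY (y : Y) : R := sumR (fun x => pXY x y).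

(* P(Y = y, W = class of z in Z^{(y)}) *)
Definition class_mass (y : Y) (z : Z) : R :=
  sumR (fun z' => if excluded_middle_informative (equiv_y y z' z) then pYZ y z' else 0).

Definition H_W_given_Y : R :=
  sumR (fun y => sumR (fun z =>
    if Req_EM_T (pYZ y z) 0 then 0
    else - (pYZ y z * log2 (class_mass y z / pY y)))).

End Rate.

(* Main.v *)
(* Single-letter structure. Pass to one letter of a code with U = (M, Y without the i-th letter):
   U - X - Y and X - (U,Y) - Z are Markov. A small leakage forces, for the typical u that produces
   z at y, the column e(u|.) to be nearly proportional to p(z|.,y). Hence the same u cannot produce
   outputs of different classes at y and y', and letting the error vanish shows that every
   proportionality class occurs for every y, with the same total weight.

   Converse. By the same argument, given (U, Y) the class W is nearly deterministic, so that
   log m >= H(M | Y^n) >= H(W^n | Y^n) - sum_i H(W_i | M, Y^n) is nearly n H(W|Y).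

   Achievability. The structure says that W is the output of a channel X -> W which does not look
   at Y, followed by a resampling of Z from (W, Y). Alice draws W^n and sends a random bin index of
   it; Bob decodes W^n from Y^n and resamples. Bob always decodes inside the announced bin, so the
   message is a function of the classes of his output and the leakage is exactly zero. *)

Require Import Defs.
From Stdlib Require Import Reals Lra Lia ZArith ClassicalEpsilon.
From HB Require Import structures.
From mathcomp Require Import all_boot.
(* [Defs.seqn] has to shadow the [seqn] of mathcomp. *)
Import Defs.

Set Implicit Arguments.
Unset Strict Implicit.
Unset Printing Implicit Defensive.

Local Open Scope R_scope.

(** * Finite sums and entropies of random variables *)

(** Leakage and error are controlled per block, while the class argument concerns one letter. Two
    uniformities bridge the gap. The one-letter informations add up to at most the leakage plus
    differences between one-letter and block entropies; these cancel exactly for an i.i.d. law, and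
    a Fannes bound keeps them small because the log-size of the block alphabet is linear in [n]. And
    the separation constant depends on [pXY] and [pZ] alone: the alphabet of U grows exponentially
    with [n], so every estimate is an L1 bound summed over u, into which the size of U does not
    enter. Full support is used to divide by [pXY x y]: this strips y from the weight of u, so that
    one may ask what the same u would produce at another y. Pinsker and Fannes are stated with a
    free parameter instead of a square root or |x| ln |x|; in this affine form they add up over the
    letters. For achievability, the leakage vanishes for every binning function, hence only the
    decoding error has to be averaged in order to fix one. *)

HB.instance Definition _ := Monoid.isComLaw.Build R 0 Rplus
  (fun x y z => esym (Rplus_assoc x y z)) Rplus_comm Rplus_0_l.
HB.instance Definition _ := Monoid.isComLaw.Build R 1 Rmult
  (fun x y z => esym (Rmult_assoc x y z)) Rmult_comm Rmult_1_l.
HB.instance Definition _ := Monoid.isMulLaw.Build R 0 Rmult Rmult_0_l Rmult_0_r.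
HB.instance Definition _ := Monoid.isAddLaw.Build R Rmult Rplus
  (fun x y z => Rmult_plus_distr_r x y z) Rmult_plus_distr_l.

Local Notation "'Sum' x .. y , F" := (sumR (fun x => .. (sumR (fun y => F)) ..))
  (at level 200, x binder, y binder, right associativity).

Section Sums.
Implicit Types T A B : finType.

Lemma eq_sumR T (f g : T -> R) : (forall t, f t = g t) -> sumR f = sumR g.
Proof. by move=> e; apply: eq_bigr => t _; apply: e. Qed.

Lemma sumR0 T (f : T -> R) : (forall t, f t = 0) -> sumR f = 0.
Proof. by move=> e; apply: big1 => t _; apply: e. Qed.

Lemma sumRD T (f g : T -> R) : (Sum t, (f t + g t)) = sumR f + sumR g.
Proof. exact: big_split. Qed.

Lemma sumRZ T c (f : T -> R) : (Sum t, (c * f t)) = c * sumR f.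
Proof. by rewrite /sumR big_distrr. Qed.

Lemma sumRZr T c (f : T -> R) : (Sum t, (f t * c)) = sumR f * c.
Proof. by rewrite /sumR big_distrl. Qed.

Lemma sumRN T (f : T -> R) : (Sum t, (- f t)) = - sumR f.
Proof.
transitivity (Sum t, ((-1) * f t)); first by apply: eq_sumR => t; ring.
by rewrite sumRZ; ring.
Qed.

Lemma sumRB T (f g : T -> R) : (Sum t, (f t - g t)) = sumR f - sumR g.
Proof. by rewrite /Rminus sumRD sumRN. Qed.

Lemma exch_sumR A B (f : A -> B -> R) : (Sum a, Sum b, f a b) = (Sum b, Sum a, f a b).
Proof. exact: exchange_big. Qed.

Lemma sumR_pair A B (f : A * B -> R) : sumR f = (Sum a, Sum b, f (a, b)).
Proof.
by rewrite /sumR pair_bigA /=; apply: eq_bigr => -[].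
Qed.

Lemma sumR_le T (f g : T -> R) : (forall t, f t <= g t) -> sumR f <= sumR g.
Proof.
move=> h; rewrite /sumR; apply: (big_ind2 (fun x y => x <= y)) => [|*|t _];
  [lra|lra|exact: h].
Qed.

Lemma sumR_ge0 T (f : T -> R) : (forall t, 0 <= f t) -> 0 <= sumR f.
Proof.
by move=> h; rewrite -(@sumR0 T (fun=> 0)) //; apply: sumR_le.
Qed.

Lemma sumR_abs T (f : T -> R) : Rabs (sumR f) <= Sum t, Rabs (f t).
Proof.
rewrite /sumR; apply: (big_ind2 (fun x y => Rabs x <= y)) => [|x1 x2 y1 y2 h1 h2|t _].
- rewrite Rabs_R0; lra.
- apply: Rle_trans (Rabs_triang _ _) _; lra.
- lra.
Qed.

Lemma sumR_delta T (a : T) (f : T -> R) : (Sum t, (if t == a then f t else 0)) = f a.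
Proof. by rewrite /sumR -big_mkcond big_pred1_eq. Qed.

Lemma sumR_delta' T (a : T) (f : T -> R) : (Sum t, (if a == t then f t else 0)) = f a.
Proof. by rewrite -[RHS]sumR_delta; apply: eq_sumR => t; rewrite eq_sym. Qed.

Lemma sumR_ge1 T (f : T -> R) a : (forall t, 0 <= f t) -> f a <= sumR f.
Proof.
move=> h; rewrite -(sumR_delta a f); apply: sumR_le => t.
by case: eqP => _; [lra|apply: h].
Qed.

Lemma sumR_const T c : (Sum _ : T, c) = INR #|T| * c.
Proof.
rewrite /sumR big_const; elim: #|T| => [|n ih]; first by rewrite /=; ring.
by rewrite iterS ih S_INR; ring.
Qed.

Lemma sumR_ord_const n c : (Sum _ : 'I_n, c) = INR n * c.
Proof. by rewrite sumR_const card_ord. Qed.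

Lemma sumR_eq0 T (f : T -> R) : (forall t, 0 <= f t) -> sumR f = 0 -> forall t, f t = 0.
Proof. by move=> h e t; have := sumR_ge1 t h; have := h t; lra. Qed.

Lemma sumR_gt0 T (f : T -> R) : (forall t, 0 <= f t) -> 0 < sumR f -> exists t, 0 < f t.
Proof.
move=> h h0; apply: NNPP => n.
suff : sumR f = 0 by lra.
apply: sumR0 => t; case: (Rle_lt_or_eq_dec _ _ (h t)) => // h1.
by case: n; exists t.
Qed.

Lemma sumR_if T (b : bool) (f : T -> R) :
  (Sum t, (if b then f t else 0)) = if b then sumR f else 0.
Proof. by case: b => //; apply: sumR0. Qed.

Lemma reindex_sumR A B (h : A -> B) (f : B -> R) : bijective h -> (Sum a, f (h a)) = sumR f.
Proof. by move=> hb; rewrite /sumR [RHS](reindex h) //; apply: onW_bij. Qed.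

End Sums.

(** * Resampling one coordinate of a finite function *)

Section Update.
Variables (I T : finType).

Definition upd (f : {ffun I -> T}) i a : {ffun I -> T} := [ffun j => if j == i then a else f j].

Lemma updE f i a j : upd f i a j = if j == i then a else f j.
Proof. by rewrite ffunE. Qed.

Lemma upd_upd f i a b : upd (upd f i a) i b = upd f i b.
Proof. by apply/ffunP => j; rewrite !updE; case: eqP. Qed.

Lemma upd_id f i : upd f i (f i) = f.
Proof. by apply/ffunP => j; rewrite !updE; case: eqP => [->|]. Qed.

(* [(f, a) |-> (upd f i a, f i)] is an involution. *)
Lemma sum_upd (r : T -> R) i (F : {ffun I -> T} -> R) : sumR r = 1 ->
  (Sum f : {ffun I -> T}, Sum a, (r (f i) * F (upd f i a))) = sumR F.
Proof.
move=> hr.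
pose h (fa : {ffun I -> T} * T) := (upd fa.1 i fa.2, fa.1 i).
have hK : cancel h h.
  by case=> f a; rewrite /h /= upd_upd upd_id updE eqxx.
transitivity (Sum f : {ffun I -> T}, Sum b, (r b * F f)).
  rewrite -(sumR_pair (fun fb : {ffun I -> T} * T => r fb.2 * F fb.1)).
  rewrite -(@reindex_sumR _ _ h); last by exists h.
  by rewrite sumR_pair.
by apply: eq_sumR => f; rewrite sumRZr hr; ring.
Qed.

End Update.

Lemma ln_le_ x y : 0 < x -> x <= y -> ln x <= ln y.
Proof. by move=> h [h1|->]; [apply: Rlt_le; apply: ln_increasing|lra]. Qed.

(** * Laws and entropies of random variables on a finite space *)

Section RandomVariables.
Variables (O : finType) (P : O -> R).
Implicit Types A B C : finType.

Definition pr A (h : O -> A) (a : A) : R := Sum w, (if h w == a then P w else 0).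

Definition eta (t : R) : R := - (t * ln t).
Definition ent (T : finType) (f : T -> R) := Sum t : T, eta (f t).
(* In nats, whereas Defs uses bits. *)
Definition Hrv A (h : O -> A) : R := ent (pr h).

Lemma sum_pr A (h : O -> A) (F : A -> R) : (Sum a, (pr h a * F a)) = Sum w, (P w * F (h w)).
Proof.
transitivity (Sum a, Sum w, (if h w == a then P w * F a else 0)).
  apply: eq_sumR => a; rewrite -sumRZr; apply: eq_sumR => w; case: ifP => _ //; ring.
rewrite exch_sumR; apply: eq_sumR => w; exact: sumR_delta'.
Qed.

Lemma sum_pr1 A (h : O -> A) : sumR (pr h) = sumR P.
Proof.
have := sum_pr h (fun=> 1).
rewrite (eq_sumR (g := pr h)); last by move=> a; ring.
by move=> ->; apply: eq_sumR => w; ring.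
Qed.

Lemma Hrv_E A (h : O -> A) : Hrv h = - Sum w, (P w * ln (pr h (h w))).
Proof. by rewrite -(sum_pr h (fun a => ln (pr h a))) -sumRN. Qed.

(** Entropy depends only on the partition of [O] into fibres; tuples of variables are regrouped
    below through this criterion. *)
Lemma Hrv_equiv A B (f : O -> A) (g : O -> B) :
  (forall w w', (f w == f w') = (g w == g w')) -> Hrv f = Hrv g.
Proof.
move=> e; rewrite !Hrv_E; congr (- _); apply: eq_sumR => w; congr (_ * ln _).
by apply: eq_sumR => w'; rewrite e.
Qed.

Hypothesis P0 : forall w, 0 <= P w.

Lemma pr_ge0 A (h : O -> A) a : 0 <= pr h a.
Proof. by apply: sumR_ge0 => w; case: ifP => _; [exact: P0|lra]. Qed.

Lemma pr_self A (h : O -> A) w : P w <= pr h (h w).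
Proof.
have h1 : forall v, 0 <= (if h v == h w then P v else 0).
  by move=> v; case: ifP => _; [exact: P0|lra].
by have := sumR_ge1 w h1; rewrite eqxx.
Qed.

Lemma pr_mono A B (f : O -> A) (g : O -> B) w :
  (forall w w', g w = g w' -> f w = f w') -> pr g (g w) <= pr f (f w).
Proof.
move=> e; apply: sumR_le => v; case: eqP => [h|_].
  by rewrite (e _ _ h) eqxx; lra.
by case: ifP => _; [exact: P0|lra].
Qed.

Lemma Hrv_mono A B (f : O -> A) (g : O -> B) :
  (forall w w', g w = g w' -> f w = f w') -> Hrv f <= Hrv g.
Proof.
move=> e; rewrite !Hrv_E; apply: Ropp_le_contravar; apply: sumR_le => w.
have := P0 w; have := pr_self g w; have := pr_mono w e => h1 h2 h3.
case: (Rle_lt_or_eq_dec _ _ h3) => h4; last by rewrite -h4; lra.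
apply: Rmult_le_compat_l => //; apply: ln_le_; lra.
Qed.

End RandomVariables.

(** * Information inequalities *)

Lemma ln_le_sub1 x : 0 < x -> ln x <= x - 1.
Proof. by move=> h; have := exp_ineq1_le (ln x); rewrite exp_ln //; lra. Qed.

Lemma div_ge0 x y : 0 <= x -> 0 <= y -> 0 <= x / y.
Proof.
move=> h1 [h2|<-]; last by rewrite Rdiv_0_r; lra.
by apply: Rmult_le_pos => //; apply/Rlt_le/Rinv_0_lt_compat.
Qed.

Lemma div_gt0 x y : 0 < x -> 0 < y -> 0 < x / y.
Proof. by move=> h1 h2; apply: Rmult_lt_0_compat => //; apply: Rinv_0_lt_compat. Qed.

Lemma ln_div x y : 0 < x -> 0 < y -> ln (x / y) = ln x - ln y.
Proof.
move=> h1 h2; have h3 := Rinv_0_lt_compat _ h2.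
by rewrite ln_mult // ln_Rinv.
Qed.

(* From [ln u <= u - 1] at [u = sqrt (q / p)]. *)
Lemma hellinger_le p q : 0 <= p -> 0 <= q -> (0 < p -> 0 < q) ->
  (sqrt p - sqrt q) ^ 2 + p - q <= p * (ln p - ln q).
Proof.
move=> hp hq hpq.
have sp := sqrt_sqrt _ hp; have sq := sqrt_sqrt _ hq.
case: (Rle_lt_or_eq_dec _ _ hp) => [p0|p0]; last first.
  by rewrite -p0 sqrt_0; nra.
have q0 := hpq p0; have sp0 := sqrt_lt_R0 _ p0; have sq0 := sqrt_lt_R0 _ q0.
have := ln_le_sub1 (div_gt0 sq0 sp0); rewrite ln_div // => h.
have e : ln p - ln q = 2 * (ln (sqrt p) - ln (sqrt q)).
  by rewrite -{1}sp -{1}sq !ln_mult //; ring.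
rewrite e.
have h2 : p * (ln (sqrt q) - ln (sqrt p)) <= sqrt p * sqrt q - p.
  apply: Rle_trans (Rmult_le_compat_l _ _ _ hp h) _.
  move: sp sp0; set u := sqrt p => <- u0; apply: Req_le; field; lra.
nra.
Qed.

(** Weighted AM-GM on |p - q| = |sqrt p - sqrt q| (sqrt p + sqrt q), with [hellinger_le] for the
    squared difference. The free [d] replaces the square root of the usual inequality. *)
Lemma pinsker_pt p q d : 0 <= p -> 0 <= q -> (0 < p -> 0 < q) -> 0 < d ->
  Rabs (p - q) <= (p * (ln p - ln q) - p + q) / (2 * d) + d * (p + q).
Proof.
move=> hp hq hpq hd.
have := hellinger_le hp hq hpq.
have sp := sqrt_sqrt _ hp; have sq := sqrt_sqrt _ hq.
set D := p * _; set u := sqrt p in sp *; set v := sqrt q in sq * => h.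
have h1 : (u - v) ^ 2 / (2 * d) <= (D - p + q) / (2 * d).
  by apply: Rmult_le_compat_r; [apply/Rlt_le/Rinv_0_lt_compat; lra|lra].
have h2 : (u - v) ^ 2 / (2 * d) * (2 * d) = (u - v) ^ 2 by field; lra.
have h3 : Rabs (p - q) = Rabs (u - v) * (u + v).
  rewrite -{1}sp -{1}sq.
  have -> : u * u - v * v = (u - v) * (u + v) by ring.
  rewrite Rabs_mult; congr (_ * _); apply: Rabs_pos_eq.
  by have := sqrt_pos p; have := sqrt_pos q; rewrite -/u -/v; lra.
have h4 : (u - v) ^ 2 = Rabs (u - v) ^ 2 by rewrite pow2_abs.
move: h1 h2 h3 h4; set a := Rabs (u - v); set r := _ / _ => h1 h2 h3 h4.
have h5 : p + q = u * u + v * v by rewrite sp sq.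
rewrite h3 h5; apply: Rle_trans (Rplus_le_compat_r _ _ _ h1).
(* The first square gives 2 a d (u + v) <= a^2 + d^2 (u + v)^2, the second d^2 (u + v)^2 <= 2 d^2
   (u^2 + v^2). *)
have h6 := pow2_ge_0 (a - d * (u + v)).
have h7 := pow2_ge_0 (d * (u - v)).
have : a * (u + v) * (2 * d) <= (r + d * (u * u + v * v)) * (2 * d) by lra.
by move=> h8; apply: Rmult_le_reg_r h8; lra.
Qed.

Lemma pinsker (T : finType) (p q : T -> R) d :
  (forall t, 0 <= p t) -> (forall t, 0 <= q t) -> (forall t, 0 < p t -> 0 < q t) ->
  sumR p = 1 -> sumR q <= 1 -> 0 < d ->
  (Sum t, Rabs (p t - q t)) <= (Sum t, p t * (ln (p t) - ln (q t))) / (2 * d) + 2 * d.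
Proof.
move=> p0 q0 pq sp sq hd.
apply: Rle_trans.
  by apply: sumR_le => t; apply: (pinsker_pt (p0 t) (q0 t) (pq t) hd).
rewrite sumRD sumRZ sumRD sp /Rdiv sumRZr sumRD sumRB sp.
have h : 0 < / (2 * d) by apply: Rinv_0_lt_compat; lra.
set D := sumR _; nra.
Qed.

(** Drop the square in [hellinger_le] and sum: only the total masses survive. *)
Lemma gibbs (T : finType) (p q : T -> R) :
  (forall t, 0 <= p t) -> (forall t, 0 <= q t) -> (forall t, 0 < p t -> 0 < q t) ->
  sumR q <= sumR p -> 0 <= (Sum t, p t * (ln (p t) - ln (q t))).
Proof.
move=> p0 q0 pq sq.
have : (Sum t, (p t - q t)) <= (Sum t, p t * (ln (p t) - ln (q t))).
  apply: sumR_le => t; have := hellinger_le (p0 t) (q0 t) (pq t).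
  have := pow2_ge_0 (sqrt (p t) - sqrt (q t)); lra.
rewrite sumRB; lra.
Qed.

Lemma ln_prodn n (f : 'I_n -> R) : (forall i, 0 < f i) -> ln (prodn f) = Sum i, ln (f i).
Proof.
move=> f0; rewrite /prodn /sumR.
suff : 0 < \big[Rmult/1]_(i < n) f i /\
       ln (\big[Rmult/1]_(i < n) f i) = \big[Rplus/0]_(i < n) ln (f i) by case.
apply: (big_rec2 (fun x y => 0 < y /\ ln y = x)) => [|i x y _ [h <-]].
  by split; [lra|rewrite ln_1].
split; first by apply: Rmult_lt_0_compat.
by rewrite ln_mult.
Qed.

Lemma prodn_gt0 n (f : 'I_n -> R) : (forall i, 0 < f i) -> 0 < prodn f.
Proof.
move=> f0; apply: (big_ind (fun x => 0 < x)) => [|x y|i _] //; first lra.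
exact: Rmult_lt_0_compat.
Qed.

Lemma prodn_ge0 n (f : 'I_n -> R) : (forall i, 0 <= f i) -> 0 <= prodn f.
Proof.
move=> f0; apply: (big_ind (fun x => 0 <= x)) => [|x y|i _] //; first lra.
exact: Rmult_le_pos.
Qed.

Lemma prodnM n (f g : 'I_n -> R) : prodn (fun i => f i * g i) = prodn f * prodn g.
Proof. exact: big_split. Qed.

Lemma eq_prodn n (f g : 'I_n -> R) : (forall i, f i = g i) -> prodn f = prodn g.
Proof. by move=> e; apply: eq_bigr => i _; apply: e. Qed.

Lemma prodn1 n : prodn (fun _ : 'I_n => 1) = 1.
Proof. by apply: big1. Qed.

Lemma prodn_sum (T : finType) n (f : 'I_n -> T -> R) :
  prodn (fun i => sumR (f i)) = Sum s : seqn T n, prodn (fun i => f i (s i)).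
Proof. by rewrite /prodn /sumR bigA_distr_bigA. Qed.

Section Inequalities.
Variables (O : finType) (P : O -> R).
Hypothesis P0 : forall w, 0 <= P w.
Implicit Types A B C : finType.

Lemma pr_gt0 A (h : O -> A) w : 0 < P w -> 0 < pr P h (h w).
Proof. by have := pr_self P0 h w; lra. Qed.

Lemma pr_margl A C (f : O -> A) (g : O -> C) c :
  (Sum a, pr P (fun w => (f w, g w)) (a, c)) = pr P g c.
Proof.
rewrite exch_sumR; apply: eq_sumR => w.
rewrite -[RHS](sumR_delta' (f w) (fun=> if g w == c then P w else 0)).
by apply: eq_sumR => a; rewrite xpair_eqE; case: eqP.
Qed.

Lemma pr_comp A C (f : O -> A) (g : A -> C) c : pr (pr P f) g c = pr P (fun w => g (f w)) c.
Proof.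
transitivity (Sum a, (pr P f a * (if g a == c then 1 else 0))).
  by apply: eq_sumR => a; case: ifP => _; ring.
by rewrite sum_pr; apply: eq_sumR => w; case: ifP => _; ring.
Qed.

Lemma sum_pr_ln A (h : O -> A) (q : A -> R) :
  (Sum a, (pr P h a * (ln (pr P h a) - ln (q a)))) =
  - Hrv P h - Sum w, (P w * ln (q (h w))).
Proof.
rewrite (sum_pr P h (fun a => ln (pr P h a) - ln (q a))) Hrv_E Ropp_involutive -sumRB.
by apply: eq_sumR => w; ring.
Qed.

Lemma pr_pos_ex A (h : O -> A) a : 0 < pr P h a -> exists2 w, h w = a & 0 < P w.
Proof.
move=> /sumR_gt0 []; first by move=> w; case: ifP => _; [exact: P0|lra].
by move=> w; case: eqP => [e|_ h1]; [exists w|lra].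
Qed.

(** Cross-entropy dominates entropy. The choice of [q] yields [Hrv_subadd] (product form) and
    [Hrv_card] (uniform form). *)
Lemma gibbs_rv A (h : O -> A) (q : A -> R) :
  (forall a, 0 <= q a) -> (forall w, 0 < P w -> 0 < q (h w)) -> sumR q <= sumR P ->
  Hrv P h <= - Sum w, (P w * ln (q (h w))).
Proof.
move=> q0 hq sq.
have := @gibbs _ (pr P h) q (pr_ge0 P0 h) q0.
rewrite sum_pr1 sum_pr_ln => k.
suff : 0 <= - Hrv P h - (Sum w, P w * ln (q (h w))) by lra.
apply: k => // a /pr_pos_ex [w <-]; exact: hq.
Qed.

Section Conditional.
Variables (A B C : finType) (f : O -> A) (g : O -> B) (h : O -> C).

(** The law with the same (f,h) and (g,h) marginals under which f and g are independent given h;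
    [mutual] is the divergence of the joint law from it. Where [pr P h] vanishes the quotient is
    0. *)
Let q (t : A * B * C) : R :=
  pr P (fun w => (f w, h w)) (t.1.1, t.2) * pr P (fun w => (g w, h w)) (t.1.2, t.2) / pr P h t.2.

Definition mutual :=
  Hrv P (fun w => (f w, h w)) + Hrv P (fun w => (g w, h w)) -
  Hrv P (fun w => (f w, g w, h w)) - Hrv P h.

Let q_ge0 t : 0 <= q t.
Proof. by apply: div_ge0; [apply: Rmult_le_pos|]; apply: pr_ge0. Qed.

Let q_gt0 w : 0 < P w -> 0 < q (f w, g w, h w).
Proof.
move=> hw; apply: div_gt0; last exact: pr_gt0.
by apply: Rmult_lt_0_compat; apply: (@pr_gt0 _ (fun w => (_ w, h w))).
Qed.

Let sum_q : sumR q = sumR P.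
Proof.
rewrite sumR_pair exch_sumR -(sum_pr1 P h); apply: eq_sumR => c.
rewrite sumR_pair /q /=.
transitivity (Sum a, (pr P (fun w => (f w, h w)) (a, c) / pr P h c * pr P h c)).
  apply: eq_sumR => a; rewrite -[X in _ = _ * X](pr_margl g) -sumRZ.
  by apply: eq_sumR => b; rewrite /Rdiv; ring.
rewrite sumRZr /Rdiv sumRZr pr_margl.
case: (Req_dec (pr P h c) 0) => [->|n]; [ring|by field].
Qed.

Let D_q : (Sum t, (pr P (fun w => (f w, g w, h w)) t *
    (ln (pr P (fun w => (f w, g w, h w)) t) - ln (q t)))) = mutual.
Proof.
rewrite (@sum_pr_ln _ (fun w => (f w, g w, h w))) /mutual.
rewrite [Hrv P (fun w => (f w, h w))]Hrv_E [Hrv P (fun w => (g w, h w))]Hrv_E.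
rewrite [Hrv P h]Hrv_E.
suff -> : (Sum w, P w * ln (q (f w, g w, h w))) =
  (Sum w, P w * ln (pr P (fun w => (f w, h w)) (f w, h w))) +
  (Sum w, P w * ln (pr P (fun w => (g w, h w)) (g w, h w))) -
  (Sum w, P w * ln (pr P h (h w))) by ring.
rewrite -sumRD -sumRB; apply: eq_sumR => w.
case: (Rle_lt_or_eq_dec _ _ (P0 w)) => [hw|<-]; last ring.
rewrite /q /= ln_div ?ln_mult; first ring.
- exact: (@pr_gt0 _ (fun w => (f w, h w))).
- exact: (@pr_gt0 _ (fun w => (g w, h w))).
- by apply: Rmult_lt_0_compat; apply: (@pr_gt0 _ (fun w => (_ w, h w))).
- exact: pr_gt0.
Qed.

Let pq t : 0 < pr P (fun w => (f w, g w, h w)) t -> 0 < q t.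
Proof. by move=> /pr_pos_ex [w <- hw]; apply: q_gt0. Qed.

Lemma mutual_ge0 : 0 <= mutual.
Proof.
rewrite -D_q; apply: gibbs => //; first by move=> t; apply: pr_ge0.
by rewrite sum_q sum_pr1; lra.
Qed.

Lemma mutual_pinsker d : sumR P = 1 -> 0 < d ->
  (Sum a, Sum b, Sum c, Rabs (pr P (fun w => (f w, g w, h w)) (a, b, c) -
    pr P (fun w => (f w, h w)) (a, c) * pr P (fun w => (g w, h w)) (b, c) / pr P h c))
  <= mutual / (2 * d) + 2 * d.
Proof.
move=> sP hd; rewrite -D_q.
have := @pinsker _ (pr P (fun w => (f w, g w, h w))) q d.
rewrite sum_pr1 sum_q sP !sumR_pair => k.
apply: Rle_trans; last first.
  by apply: k => //; [move=> t; apply: pr_ge0|lra].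
by apply: Req_le; apply: eq_sumR => a; apply: eq_sumR => b; apply: eq_sumR => c.
Qed.

End Conditional.

(** Gibbs with the law of g times the product of the conditional laws of the single coordinates; by
    [prodn_sum] this product sums to 1 for each value of g of positive probability. *)
Lemma Hrv_subadd (T : finType) B n (f : O -> seqn T n) (g : O -> B) :
  Hrv P (fun w => (f w, g w)) - Hrv P g <=
  Sum i : 'I_n, (Hrv P (fun w => (f w i, g w)) - Hrv P g).
Proof.
pose r (i : 'I_n) a b := pr P (fun w => (f w i, g w)) (a, b) / pr P g b.
pose q (t : seqn T n * B) := pr P g t.2 * prodn (fun i => r i (t.1 i) t.2).
have r0 i w : 0 < P w -> 0 < r i (f w i) (g w).
  by move=> hw; apply: div_gt0; [exact: (@pr_gt0 _ (fun w => (f w i, g w)))|exact: pr_gt0].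
have k : Hrv P (fun w => (f w, g w)) <= - Sum w, (P w * ln (q (f w, g w))).
  apply: (@gibbs_rv _ (fun w => (f w, g w)) q) => [[x b]|w hw|].
  - apply: Rmult_le_pos; first exact: pr_ge0.
    by apply: prodn_ge0 => i; apply: div_ge0; apply: pr_ge0.
  - apply: Rmult_lt_0_compat; first exact: pr_gt0.
    by apply: prodn_gt0 => i; apply: r0.
  rewrite sumR_pair exch_sumR -(sum_pr1 P g); apply: sumR_le => b.
  rewrite /q /= sumRZ -(prodn_sum (fun i a => r i a b)).
  case: (Rle_lt_or_eq_dec _ _ (pr_ge0 P0 g b)) => [hb|<-]; last lra.
  rewrite (eq_prodn (g := fun=> 1)) ?prodn1; first lra.
  by move=> i; rewrite /Rdiv sumRZr (@pr_margl _ _ (fun w => f w i)); field; lra.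
suff e : - (Sum w, P w * ln (q (f w, g w))) =
   Hrv P g + Sum i : 'I_n, (Hrv P (fun w => (f w i, g w)) - Hrv P g) by lra.
transitivity (- (Sum w, P w * ln (pr P g (g w))) -
  Sum i : 'I_n, Sum w, P w * ln (r i (f w i) (g w))).
  rewrite exch_sumR /Rminus -Ropp_plus_distr -sumRD; congr (- _); apply: eq_sumR => w.
  rewrite sumRZ; case: (Rle_lt_or_eq_dec _ _ (P0 w)) => [hw|<-]; last ring.
  rewrite /q ln_mult ?ln_prodn /=; first ring.
  - by move=> i; apply: r0.
  - exact: pr_gt0.
  - by apply: prodn_gt0 => i; apply: r0.
rewrite -Hrv_E /Rminus -sumRN; congr (_ + _); apply: eq_sumR => i.
rewrite !Hrv_E Ropp_involutive -!sumRN -sumRD; apply: eq_sumR => w.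
case: (Rle_lt_or_eq_dec _ _ (P0 w)) => [hw|<-]; last ring.
rewrite /r ln_div; first ring.
  exact: (@pr_gt0 _ (fun w => (f w i, g w))).
exact: pr_gt0.
Qed.

Lemma Hrv_card A B (f : O -> A) (g : O -> B) : sumR P = 1 -> (0 < #|A|)%N ->
  Hrv P (fun w => (f w, g w)) - Hrv P g <= ln (INR #|A|).
Proof.
move=> sP hA; have hA' : 0 < INR #|A| by apply/lt_0_INR/ltP.
have k : Hrv P (fun w => (f w, g w)) <= - Sum w, (P w * ln (pr P g (g w) / INR #|A|)).
  apply: (@gibbs_rv _ (fun w => (f w, g w)) (fun t => pr P g t.2 / INR #|A|)) => [[x b]|w hw|].
  - by apply: div_ge0; [exact: pr_ge0|lra].
  - by apply: div_gt0; [exact: pr_gt0|lra].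
  rewrite sumR_pair /= sumR_const /Rdiv sumRZr sum_pr1; rewrite sP Rmult_1_l Rinv_r; lra.
have e : (Sum w, (P w * ln (pr P g (g w) / INR #|A|))) =
   (Sum w, (P w * ln (pr P g (g w)))) - (Sum w, P w * ln (INR #|A|)).
  rewrite -sumRB; apply: eq_sumR => w.
  case: (Rle_lt_or_eq_dec _ _ (P0 w)) => [hw|<-]; last ring.
  by rewrite ln_div //; [ring|exact: pr_gt0].
move: k; rewrite e sumRZr sP [Hrv P g]Hrv_E; lra.
Qed.

End Inequalities.

(** * Continuity of entropy in the L1 distance *)

Section Fannes.

(** The right-hand side is the tangent at [s] to the concave function [eta]. *)
Lemma eta_le s r : 0 <= r -> 0 < s -> eta r <= r * ln (/ s) + s - r.
Proof.
move=> hr hs; rewrite /eta ln_Rinv //.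
case: (Rle_lt_or_eq_dec _ _ hr) => [h|<-]; last lra.
have := ln_le_sub1 (div_gt0 hs h); rewrite ln_div // => k.
have := Rmult_le_compat_l _ _ _ hr k.
have -> : r * (s / r - 1) = s - r by field; lra.
nra.
Qed.

(** Affine substitute for the modulus |x - y| ln (1/|x - y|), with [s] free. If x <= y, use that the
    slope of [eta] is at least -1 on the unit interval; if x > y, [eta] is subadditive and [eta_le]
    bounds [eta (x - y)]. *)
Lemma eta_diff s x y : 0 <= x <= 1 -> 0 <= y <= 1 -> 0 < s <= 1 ->
  eta x - eta y <= Rabs (x - y) * (ln (/ s) + 1) + s.
Proof.
move=> hx hy hs.
have ls : 0 <= ln (/ s).
  rewrite -ln_1; apply: ln_le_; first lra.
  by rewrite -Rinv_1; apply: Rinv_le_contravar; lra.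
have := Rabs_pos (x - y).
case: (Rle_lt_dec x y) => h.
  rewrite Rabs_minus_sym (Rabs_pos_eq (y - x)); last lra.
  suff : eta x - eta y <= y - x by nra.
  rewrite /eta; have := proj1 hx; case/Rle_lt_or_eq_dec => x0.
    have ly : ln y <= 0 by rewrite -ln_1; apply: ln_le_; lra.
    have y0 : 0 < y by lra.
    have := ln_le_sub1 (div_gt0 y0 x0); rewrite ln_div // => k.
    have := Rmult_le_compat_l _ _ _ (proj1 hx) k.
    have -> : x * (y / x - 1) = y - x by field; lra.
    nra.
  rewrite -x0; have := proj1 hy; case/Rle_lt_or_eq_dec => y0; last by rewrite -y0; lra.
  have ly : ln y <= 0 by rewrite -ln_1; apply: ln_le_; lra.
  nra.
rewrite Rabs_pos_eq; last lra.
have hr : 0 <= x - y by lra.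
have := eta_le hr (proj1 hs).
suff : eta x <= eta y + eta (x - y) by lra.
rewrite /eta.
have h1 : ln (x - y) <= ln x by apply: ln_le_; lra.
suff : y * ln y <= y * ln x by nra.
have := proj1 hy; case/Rle_lt_or_eq_dec => y0; last by rewrite -y0; lra.
by apply: Rmult_le_compat_l; [lra|apply: ln_le_; lra].
Qed.

Lemma ent_diff (T : finType) (f g : T -> R) s :
  (forall t, 0 <= f t <= 1) -> (forall t, 0 <= g t <= 1) -> 0 < s <= 1 ->
  ent f - ent g <= (Sum t, Rabs (f t - g t)) * (ln (/ s) + 1) + INR #|T| * s.
Proof.
move=> hf hg hs; rewrite /ent -sumRB -sumR_const -sumRZr -sumRD.
by apply: sumR_le => t; apply: eta_diff.
Qed.

(** Triangle inequality inside each fibre: data processing for the L1 distance. *)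
Lemma pr_dist (T A : finType) (f g : T -> R) (h : T -> A) :
  (Sum a, Rabs (pr f h a - pr g h a)) <= Sum t, Rabs (f t - g t).
Proof.
rewrite -(sum_pr1 (fun t => Rabs (f t - g t)) h); apply: sumR_le => a.
rewrite /pr -sumRB; apply: Rle_trans (sumR_abs _) _; apply: sumR_le => t.
by case: ifP => _; [lra|rewrite Rminus_0_r Rabs_R0; lra].
Qed.

End Fannes.

(** * Product laws *)

Lemma prodn_eq0 n (f : 'I_n -> R) i : f i = 0 -> prodn f = 0.
Proof. by move=> e; rewrite /prodn (bigD1 i) //= e Rmult_0_l. Qed.

(** Writes a factor at one coordinate as a product over all of them, so that [prodn_sum] can factor
    expectations of functions of one or two coordinates. *)
Lemma prodn_at n (i : 'I_n) c : prodn (fun j => if j == i then c else 1) = c.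
Proof. by rewrite /prodn -big_mkcond big_pred1_eq. Qed.

Lemma prodn_if n (b : 'I_n -> bool) (f : 'I_n -> R) :
  prodn (fun i => if b i then f i else 0) = if [forall i, b i] then prodn f else 0.
Proof.
case: forallP => [h|h].
  by apply: eq_prodn => i; rewrite h.
have [i hi] : exists i, ~~ b i by apply/existsP; rewrite -negb_forall; apply/forallP.
by apply: (prodn_eq0 (i := i)); rewrite (negbTE hi).
Qed.

Definition mapn (T S : finType) n (h : T -> S) (s : seqn T n) : seqn S n := [ffun i => h (s i)].

Section Iid.
Variables (T : finType) (n : nat) (g : T -> R).

Definition iid (s : seqn T n) : R := prodn (fun i => g (s i)).

Lemma pr_iid (S : finType) (h : T -> S) t :
  pr iid (mapn h) t = prodn (fun i => pr g h (t i)).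
Proof.
rewrite prodn_sum; apply: eq_sumR => s; rewrite prodn_if; congr (if _ then _ else _).
apply/eqP/forallP => [<- i|e]; first by rewrite ffunE.
by apply/ffunP => i; rewrite ffunE; apply/eqP.
Qed.

Lemma iid_ge0 : (forall a, 0 <= g a) -> forall s, 0 <= iid s.
Proof. by move=> h s; apply: prodn_ge0. Qed.

Hypothesis g1 : sumR g = 1.

Lemma sum_iid : sumR iid = 1.
Proof. by rewrite /iid -(prodn_sum (fun=> g)) (eq_prodn (g := fun=> 1)) ?prodn1. Qed.

Lemma iid_marg i (F : T -> R) : (Sum s, (iid s * F (s i))) = Sum a, g a * F a.
Proof.
transitivity (Sum s : seqn T n, prodn (fun j => g (s j) * (if j == i then F (s j) else 1))).
  apply: eq_sumR => s; rewrite prodnM; congr (_ * _).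
  rewrite -[LHS](prodn_at i (F (s i))); apply: eq_prodn => j; by case: eqP => [->|].
rewrite -(prodn_sum (fun j a => g a * (if j == i then F a else 1))).
rewrite -[RHS](prodn_at i); apply: eq_prodn => j; case: eqP => // _.
by rewrite -[RHS]g1; apply: eq_sumR => a; ring.
Qed.

Lemma iid_marg2 i j (F G : T -> R) : i != j ->
  (Sum s, (iid s * (F (s i) * G (s j)))) = (Sum a, g a * F a) * (Sum a, g a * G a).
Proof.
move=> ij.
transitivity (Sum s : seqn T n, prodn (fun k => g (s k) *
    ((if k == i then F (s k) else 1) * (if k == j then G (s k) else 1)))).
  apply: eq_sumR => s; rewrite 2!prodnM; congr (_ * (_ * _)).
    rewrite -[LHS](prodn_at i (F (s i))); apply: eq_prodn => k; by case: eqP => [->|].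
  rewrite -[LHS](prodn_at j (G (s j))); apply: eq_prodn => k; by case: eqP => [->|].
rewrite -(prodn_sum (fun k a => g a * ((if k == i then F a else 1) * (if k == j then G a else 1)))).
rewrite -[X in X * _](prodn_at i) -[X in _ * X](prodn_at j) -prodnM; apply: eq_prodn => k.
case: (eqVneq k i) => [->|_].
  by rewrite (negbTE ij) Rmult_1_r; apply: eq_sumR => a; ring.
case: eqP => _; first by rewrite Rmult_1_l; apply: eq_sumR => a; ring.
by rewrite Rmult_1_r -[RHS]g1; apply: eq_sumR => a; ring.
Qed.

Lemma pr_iid_coord (S : finType) (h : T -> S) i t :
  pr iid (fun s => h (s i)) t = pr g h t.
Proof.
transitivity (Sum s, iid s * (if h (s i) == t then 1 else 0)).
  by apply: eq_sumR => s; case: ifP => _; ring.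
rewrite (iid_marg i (fun a => if h a == t then 1 else 0)).
by apply: eq_sumR => s; case: ifP => _; ring.
Qed.

Hypothesis g0 : forall a, 0 <= g a.

Lemma ent_iid : ent iid = INR n * ent g.
Proof.
have e s : eta (iid s) = Sum i : 'I_n, - (iid s * ln (g (s i))).
  rewrite sumRN sumRZ /eta; congr (- _).
  case: (excluded_middle_informative (forall i, 0 < g (s i))) => [h|h].
    by rewrite {2}/iid ln_prodn.
  have [i hi] := not_all_ex_not _ _ h.
  have -> : iid s = 0; last by ring.
  apply: (prodn_eq0 (i := i)); have := g0 (s i); lra.
rewrite /ent (eq_sumR e) exch_sumR.
transitivity (Sum i : 'I_n, ent g); last by rewrite sumR_const card_ord.
apply: eq_sumR => i; rewrite sumRN (iid_marg i (fun a => ln (g a))) -sumRN.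
by apply: eq_sumR.
Qed.

(** Second moment of the centred sum: independence of distinct coordinates kills the covariances and
    leaves n times the variance. *)
Lemma chebyshev (V : T -> R) d : (0 < n)%N -> 0 < d ->
  (Sum s : seqn T n, (if Rlt_dec (INR n * ((Sum a, g a * V a) + d)) (Sum i, V (s i))
           then iid s else 0)) <= (Sum a, g a * (V a - Sum a, g a * V a) ^ 2) / (INR n * d ^ 2).
Proof.
move=> n0 hd; set mu := (X in INR n * (X + d)).
have hn : 0 < INR n by apply/lt_0_INR/ltP.
pose U a := V a - mu.
have U0 : (Sum a, g a * U a) = 0.
  rewrite (eq_sumR (g := fun a => g a * V a - g a * mu)); last by move=> a; rewrite /U; ring.
  by rewrite sumRB sumRZr g1; rewrite -/mu; ring.
have e : (Sum s : seqn T n, iid s * (Sum i, U (s i)) ^ 2) = INR n * Sum a, g a * U a ^ 2.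
  transitivity (Sum i : 'I_n, Sum j : 'I_n, Sum s : seqn T n, iid s * (U (s i) * U (s j))).
    under [RHS]eq_sumR => i do rewrite exch_sumR.
    rewrite exch_sumR; apply: eq_sumR => s.
    under [RHS]eq_sumR => i do rewrite !sumRZ.
    by rewrite sumRZ sumRZr; ring.
  transitivity (Sum i : 'I_n, Sum a, g a * U a ^ 2); last by rewrite sumR_const card_ord.
  apply: eq_sumR => i; rewrite -[RHS](sumR_delta i (fun=> Sum a, g a * U a ^ 2)).
  apply: eq_sumR => j; case: eqP => [->|/eqP ij].
    by rewrite (iid_marg i (fun a => U a * U a)); apply: eq_sumR => a; ring.
  by rewrite iid_marg2 1?eq_sym // U0; ring.
have hp : 0 < (INR n * d) ^ 2 by apply: pow_lt; apply: Rmult_lt_0_compat.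
apply: (Rmult_le_reg_r ((INR n * d) ^ 2)) => //.
have -> : (Sum a, g a * (V a - mu) ^ 2) / (INR n * d ^ 2) * (INR n * d) ^ 2 =
  INR n * (Sum a, g a * U a ^ 2) by rewrite /U; field; lra.
rewrite -e -sumRZr; apply: sumR_le => s.
have i0 := iid_ge0 g0 s; have := pow2_ge_0 (Sum i, U (s i)) => p0.
case: Rlt_dec => h; last by rewrite Rmult_0_l; apply: Rmult_le_pos.
apply: Rmult_le_compat_l => //; apply: pow_incr; split.
  by apply: Rmult_le_pos; lra.
rewrite /U sumRB sumR_const card_ord.
rewrite Rmult_plus_distr_l in h; lra.
Qed.

End Iid.

(** * One-shot protocols *)

(** Makes finitely many existential constants uniform: by monotonicity, one plus the sum of their
    absolute values serves for all. *)
Lemma finite_bound (T : finType) (Q : T -> R -> Prop) :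
  (forall t c c', Q t c -> c <= c' -> Q t c') -> (forall t, exists c, Q t c) ->
  exists2 c, 0 < c & forall t, Q t c.
Proof.
move=> mono ex.
pose c t := proj1_sig (constructive_indefinite_description _ (ex t)).
have cP t : Q t (c t) by rewrite /c; case: constructive_indefinite_description.
have p0 t : 0 <= Rabs (c t) by apply: Rabs_pos.
exists (1 + Sum t, Rabs (c t)) => [|t]; first by have := sumR_ge0 p0; lra.
apply: mono (cP t) _; have := sumR_ge1 t p0; have := Rle_abs (c t); lra.
Qed.

Section OneShot.
Variables (X Y Z : finType) (pXY : X -> Y -> R) (pZ : X -> Y -> Z -> R).
Hypothesis p_pos : forall x y, 0 < pXY x y.
Hypothesis p_sum : sumR (fun xy : (X * Y)%type => pXY xy.1 xy.2) = 1.
Hypothesis pZ_pmf : forall x y, is_pmf (pZ x y).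

(** The vector gamma of the factorization: as alpha is a probability vector on [X], the scalar
    factor is the column sum. *)
Definition gam y z := Sum x, pZ x y z.

(** Proportionality of two columns that may belong to different y, cross-multiplied to avoid
    quotients; positivity puts z in Z^(y) and z' in Z^(y'). *)
Definition same_class y z y' z' : Prop :=
  [/\ 0 < gam y z, 0 < gam y' z' & forall x, pZ x y z * gam y' z' = pZ x y' z' * gam y z].

Lemma pZ_le1 x y z : 0 <= pZ x y z <= 1.
Proof. by have [h s] := pZ_pmf x y; split => //; rewrite -s; apply: sumR_ge1. Qed.

Lemma p_le1 x y : pXY x y <= 1.
Proof.
rewrite -p_sum; apply: (sumR_ge1 (f := fun xy : X * Y => pXY xy.1 xy.2) (x, y)) => -[a b] /=.
exact: Rlt_le.
Qed.

Lemma gam_ge0 y z : 0 <= gam y z.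
Proof. by apply: sumR_ge0 => x; case: (pZ_le1 x y z). Qed.

Lemma gam_le y z : gam y z <= INR #|X|.
Proof.
rewrite -[INR _]Rmult_1_r -sumR_const; apply: sumR_le => x; by case: (pZ_le1 x y z).
Qed.

(** Full support in quantitative form: dividing by [pXY x y] costs a factor [c]. *)
Lemma p_inv_bound : exists2 c, 0 < c & forall x y, 1 <= c * pXY x y.
Proof.
have [||c c0 h] := @finite_bound (X * Y)%type (fun t c => 1 <= c * pXY t.1 t.2).
- move=> t c c' h hc; apply: Rle_trans h _; apply: Rmult_le_compat_r => //; exact: Rlt_le.
- move=> t; exists (/ pXY t.1 t.2); rewrite Rinv_l; first lra.
  by have := p_pos t.1 t.2; lra.
by exists c => // x y; apply: (h (x, y)).
Qed.

(* [U] is an auxiliary variable with [U - X - Y] and [X - (U,Y) - Z] Markov: [e x u] and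
   [d u y z] are its (unnormalised) encoder and decoder kernels. [D] bounds the distance to the
   target law, [K] the distance from the independence of [U] and [X] given [(Y, Z)]. *)
Record near_secure (U : finType) (e : X -> U -> R) (d : U -> Y -> Z -> R) (D K : R) : Prop :=
  NearSecure {
    ns_e : forall x u, 0 <= e x u;
    ns_d : forall u y z, 0 <= d u y z <= 1;
    ns_le1 : forall y z, (Sum x, Sum u, pXY x y * e x u * d u y z) <= 1;
    ns_D : forall x y z, Rabs ((Sum u, pXY x y * e x u * d u y z) - pXY x y * pZ x y z) <= D;
    ns_K : forall x y z, (Sum u, Rabs (pXY x y * e x u * d u y z -
       (Sum x', pXY x' y * e x' u * d u y z) *
       ((Sum u', pXY x y * e x u' * d u' y z) /
        (Sum x', Sum u', pXY x' y * e x' u' * d u' y z)))) <= K }.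

(** * Estimates for one auxiliary variable *)

Section Bounds.
Variables (U : finType) (e : X -> U -> R) (d : U -> Y -> Z -> R) (D K c : R).
Hypothesis ns : near_secure e d D K.
Hypothesis c_pos : 0 < c.
Hypothesis cP : forall x y, 1 <= c * pXY x y.

Let Ph x y z := Sum u, pXY x y * e x u * d u y z.
Let Pyz y z := Sum x, Ph x y z.
Let S u := Sum x, e x u.

Let pe_ge0 x y z u : 0 <= pXY x y * e x u * d u y z.
Proof.
case: (ns_d ns u y z) => h _; have := ns_e ns x u => h'.
by do 2?apply: Rmult_le_pos => //; apply: Rlt_le.
Qed.

Let Ph_ge0 x y z : 0 <= Ph x y z.
Proof. by apply: sumR_ge0 => u; apply: pe_ge0. Qed.

Let Ph_le x y z : Ph x y z <= Pyz y z.
Proof. exact: (sumR_ge1 (f := fun x => Ph x y z)). Qed.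

Let S_ge0 u : 0 <= S u.
Proof. by apply: sumR_ge0 => x; apply: ns_e ns x u. Qed.

(** After division by [pXY x y] the weight [S u] is free of y: one measure on [U] reproduces the
    column sums at every y. Each x costs c D. *)
Lemma near_secure_marg y z :
  Rabs ((Sum u, S u * d u y z) - gam y z) <= INR #|X| * (c * D).
Proof.
have -> : (Sum u, S u * d u y z) = Sum x, Sum u, e x u * d u y z.
  by rewrite exch_sumR; apply: eq_sumR => u; rewrite sumRZr.
rewrite -sumRB; apply: Rle_trans (sumR_abs _) _; rewrite -sumR_const; apply: sumR_le => x.
have -> : c * D = c * pXY x y * (D / pXY x y) by field; have := p_pos x y; lra.
have -> : (Sum u, e x u * d u y z) - pZ x y z = (Ph x y z - pXY x y * pZ x y z) / pXY x y.
  have -> : Ph x y z = pXY x y * Sum u, e x u * d u y z.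
    by rewrite -sumRZ; apply: eq_sumR => u; ring.
  by field; have := p_pos x y; lra.
have i0 : 0 < / pXY x y by apply: Rinv_0_lt_compat.
rewrite /Rdiv Rabs_mult (Rabs_pos_eq (/ _)); last lra.
rewrite -[X in X <= _]Rmult_1_l; apply: Rmult_le_compat => //; first lra.
  by apply: Rmult_le_pos; [apply: Rabs_pos|lra].
by apply: Rmult_le_compat_r; [lra|exact: (ns_D ns x y z)].
Qed.

(** Near independence given (y,z) makes [pXY x y * e x u * d u y z] close to [E u * q x].
    Cross-multiplying the approximations for x and x' eliminates the unknown [E u], and each
    contributes at most K. *)
Let cross1 x x' y z :
  (Sum u, d u y z * Rabs (pXY x y * e x u * Ph x' y z - pXY x' y * e x' u * Ph x y z)) <= 2 * K.
Proof.
pose q x := Ph x y z / Pyz y z.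
have Pyz0 : 0 <= Pyz y z by apply: sumR_ge0.
have qE a : q a * Pyz y z = Ph a y z.
  case: (Rle_lt_or_eq_dec _ _ Pyz0) => h; first by rewrite /q; field; lra.
  by have := Ph_le a y z; have := Ph_ge0 a y z; rewrite -h; lra.
have q0 a : 0 <= q a by apply: div_ge0.
have P1 : Pyz y z <= 1 by apply: (ns_le1 ns y z).
pose E u := Sum x, pXY x y * e x u * d u y z.
pose A a u := Rabs (pXY a y * e a u * d u y z - E u * q a).
have AK a : (Sum u, A a u) <= K := ns_K ns a y z.
apply: Rle_trans (_ : (Sum u, A x u + A x' u) <= _); last first.
  by rewrite sumRD; apply: Rle_trans (Rplus_le_compat _ _ _ _ (AK x) (AK x')) _; lra.
apply: sumR_le => u; have [d0 d1] := ns_d ns u y z.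
rewrite -{1}(Rabs_pos_eq _ d0) -Rabs_mult -(qE x) -(qE x').
have -> : d u y z * (pXY x y * e x u * (q x' * Pyz y z) - pXY x' y * e x' u * (q x * Pyz y z)) =
  Ph x' y z * (pXY x y * e x u * d u y z - E u * q x) -
  Ph x y z * (pXY x' y * e x' u * d u y z - E u * q x') by rewrite -(qE x) -(qE x'); ring.
have lem a b r : 0 <= r <= 1 -> Rabs (a - r * b) <= Rabs a + Rabs b.
  move=> [r0 r1]; apply: Rle_trans (Rabs_triang _ _) _.
  rewrite Rabs_Ropp Rabs_mult (Rabs_pos_eq r) //; have := Rabs_pos b; nra.
have Ph1 a : 0 <= Ph a y z <= 1 by split => //; have := Ph_le a y z; lra.
apply: Rle_trans (lem _ _ _ (Ph1 x)) _; apply: Rplus_le_compat_r.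
rewrite Rabs_mult (Rabs_pos_eq (Ph x' y z)) //.
have := Rabs_pos (pXY x y * e x u * d u y z - E u * q x).
rewrite -/(A x u); have := Ph1 x'; nra.
Qed.

(** Replaces [Ph] by the target law at the cost of D, and divides by [pXY x y * pXY x' y] at the
    cost of c^2. *)
Let cross2 x x' y z :
  (Sum u, d u y z * Rabs (e x u * pZ x' y z - e x' u * pZ x y z)) <= c ^ 2 * (2 * K + 2 * D).
Proof.
have key u : d u y z * Rabs (e x u * pZ x' y z - e x' u * pZ x y z) <= c ^ 2 *
   (d u y z * Rabs (pXY x y * e x u * Ph x' y z - pXY x' y * e x' u * Ph x y z) +
    (pXY x y * e x u * d u y z * D + pXY x' y * e x' u * d u y z * D)).
  have [d0 d1] := ns_d ns u y z.
  set r := Rabs (_ - _).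
  have h1 : d u y z * r <= c ^ 2 * (d u y z * (pXY x y * pXY x' y * r)).
    have h : 1 <= (c * pXY x y) * (c * pXY x' y) by have := cP x y; have := cP x' y; nra.
    have h0 : 0 <= d u y z * r by apply: Rmult_le_pos => //; apply: Rabs_pos.
    nra.
  apply: Rle_trans h1 _; apply: Rmult_le_compat_l; first by apply: pow_le; lra.
  have hp := p_pos x y; have hp' := p_pos x' y; have he := ns_e ns x u; have he' := ns_e ns x' u.
  have -> : pXY x y * pXY x' y * r = Rabs (
     (pXY x y * e x u * Ph x' y z - pXY x' y * e x' u * Ph x y z) -
     (pXY x y * e x u * (Ph x' y z - pXY x' y * pZ x' y z) -
      pXY x' y * e x' u * (Ph x y z - pXY x y * pZ x y z))).
    rewrite -(Rabs_pos_eq (pXY x y * pXY x' y)); last nra.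
    by rewrite /r -Rabs_mult; congr Rabs; ring.
  set t := _ - pXY x' y * e x' u * Ph x y z.
  have hD := ns_D ns x y z; have hD' := ns_D ns x' y z.
  rewrite -/(Ph x y z) in hD; rewrite -/(Ph x' y z) in hD'.
  set s := _ - _ in hD; set s' := _ - _ in hD'.
  have h2 : Rabs (t - (pXY x y * e x u * s' - pXY x' y * e x' u * s)) <=
    Rabs t + (pXY x y * e x u * D + pXY x' y * e x' u * D).
    apply: Rle_trans (Rabs_triang _ _) _; apply: Rplus_le_compat_l.
    rewrite Rabs_Ropp; apply: Rle_trans (Rabs_triang _ _) _; rewrite Rabs_Ropp !Rabs_mult.
    rewrite !(Rabs_pos_eq (pXY _ _)) ?(Rabs_pos_eq (e _ _)) //; try lra.
    by apply: Rplus_le_compat; apply: Rmult_le_compat_l => //; apply: Rmult_le_pos; lra.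
  apply: Rle_trans (Rmult_le_compat_l _ _ _ d0 h2) _; apply: Req_le; ring.
apply: Rle_trans (sumR_le key) _; rewrite sumRZ !sumRD !sumRZr.
apply: Rmult_le_compat_l; first by apply: pow_le; lra.
have := @cross1 x x' y z; rewrite -/(Ph x y z) -/(Ph x' y z) => h.
have Ph1 a : Ph a y z <= 1 by apply: Rle_trans (Ph_le a y z) (ns_le1 ns y z).
have D0 : 0 <= D by apply: Rle_trans (ns_D ns x y z); apply: Rabs_pos.
have := Ph1 x; have := Ph1 x'; nra.
Qed.

Let L := INR #|X| * (c ^ 2 * (2 * K + 2 * D)).

(** Sum [cross2] over x': wherever [d u y z] has weight, the column e(.,u) is nearly parallel to the
    target column at (y,z). *)
Let cross3 x y z : (Sum u, d u y z * Rabs (e x u * gam y z - S u * pZ x y z)) <= L.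
Proof.
apply: Rle_trans (_ : (Sum x', Sum u, d u y z * Rabs (e x u * pZ x' y z - e x' u * pZ x y z)) <= _).
  rewrite exch_sumR; apply: sumR_le => u; rewrite sumRZ.
  apply: Rmult_le_compat_l; first by case: (ns_d ns u y z).
  apply: Rle_trans (sumR_abs _); apply: Req_le; congr Rabs.
  by rewrite sumRB sumRZ sumRZr.
by rewrite /L -sumR_const; apply: sumR_le => x'; apply: cross2.
Qed.

(** If u can produce both z at y and z' at y', then its column is nearly parallel to both target
    columns. So columns that are not proportional leave little weight on such u. *)
Lemma near_secure_cross x y z y' z' :
  (Sum u, S u * d u y z * d u y' z') * Rabs (pZ x y z * gam y' z' - pZ x y' z' * gam y z)
  <= 2 * INR #|X| * L.
Proof.
set n := INR #|X|.
have k : (Sum u, S u * d u y z * d u y' z') * Rabs (pZ x y z * gam y' z' - pZ x y' z' * gam y z)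
  <= Sum u, n * (d u y z * Rabs (e x u * gam y z - S u * pZ x y z)) +
            n * (d u y' z' * Rabs (e x u * gam y' z' - S u * pZ x y' z')).
  rewrite -sumRZr; apply: sumR_le => u.
  have [d0 d1] := ns_d ns u y z; have [d0' d1'] := ns_d ns u y' z'.
  have g1 := gam_le y z; have g2 := gam_le y' z'; have g3 := gam_ge0 y z; have g4 := gam_ge0 y' z'.
  set a := e x u * gam y z - _; set b := e x u * gam y' z' - _.
  (* The terms in [e x u] cancel between [a] and [b]; the cross difference of the target columns
     remains, with weight [S u]. *)
  have -> : S u * d u y z * d u y' z' * Rabs (pZ x y z * gam y' z' - pZ x y' z' * gam y z) =
    Rabs (gam y z * d u y z * d u y' z' * b - gam y' z' * d u y z * d u y' z' * a).
    rewrite -(Rabs_pos_eq (S u * d u y z * d u y' z')); last by do 2?apply: Rmult_le_pos.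
    by rewrite -Rabs_mult; congr Rabs; rewrite /a /b; ring.
  have lem g r r' v : 0 <= g <= n -> 0 <= r <= 1 -> 0 <= r' <= 1 ->
      Rabs (g * r * r' * v) <= n * (r' * Rabs v).
    move=> hg hr hr'; rewrite !Rabs_mult (Rabs_pos_eq g) ?(Rabs_pos_eq r) ?(Rabs_pos_eq r'); try lra.
    have -> : g * r * r' * Rabs v = (g * r) * (r' * Rabs v) by ring.
    apply: Rmult_le_compat_r; first by apply: Rmult_le_pos; [lra|apply: Rabs_pos].
    have : g * r <= g * 1 by apply: Rmult_le_compat_l; lra.
    lra.
  apply: Rle_trans (Rabs_triang _ _) _; rewrite Rabs_Ropp Rplus_comm.
  apply: Rplus_le_compat; last by apply: lem.
  have -> : gam y' z' * d u y z * d u y' z' * a = gam y' z' * d u y' z' * d u y z * a by ring.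
  by apply: lem.
apply: Rle_trans k _; rewrite sumRD !sumRZ.
have n0 : 0 <= n by apply: pos_INR.
have := cross3 x y z; have := cross3 x y' z'; nra.
Qed.

End Bounds.

(** [C] is chosen before [U], [e] and [d], hence serves every block length. It is uniform over the
    finitely many (y,z,y',z'), and contains the inverse of a nonzero cross difference of columns
    that are not proportional. *)
Lemma near_secure_separation : exists2 C, 0 < C &
  forall (U : finType) (e : X -> U -> R) (d : U -> Y -> Z -> R) (D K : R),
  near_secure e d D K -> forall y z,
  Rabs ((Sum u, (Sum x, e x u) * d u y z) - gam y z) <= C * D /\
  forall y' z', ~ same_class y z y' z' ->
    (Sum u, (Sum x, e x u) * d u y z * d u y' z') <= C * (D + K).
Proof.
have [c c0 cP] := p_inv_bound.
have n0 : 0 <= INR #|X| by apply: pos_INR.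
pose Q (t : (Y * Z) * (Y * Z)) C :=
  forall (U : finType) (e : X -> U -> R) (d : U -> Y -> Z -> R) (D K : R),
  near_secure e d D K -> 0 <= D -> 0 <= K ->
  Rabs ((Sum u, (Sum x, e x u) * d u t.1.1 t.1.2) - gam t.1.1 t.1.2) <= C * D /\
  (~ same_class t.1.1 t.1.2 t.2.1 t.2.2 ->
    (Sum u, (Sum x, e x u) * d u t.1.1 t.1.2 * d u t.2.1 t.2.2) <= C * (D + K)).
have [||C C0 h] := @finite_bound _ Q.
- move=> t C C' h hC U e d D K ns D0 K0; have [h1 h2] := h _ _ _ _ _ ns D0 K0; split.
    by apply: Rle_trans h1 _; apply: Rmult_le_compat_r.
  by move=> /h2 h3; apply: Rle_trans h3 _; apply: Rmult_le_compat_r; lra.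
- case=> -[y z] [y' z']; rewrite /Q /=.
  have hm : exists2 C, 0 <= C &
    forall (U : finType) (e : X -> U -> R) (d : U -> Y -> Z -> R) (D K : R),
    near_secure e d D K -> 0 <= D -> 0 <= K -> ~ same_class y z y' z' ->
    (Sum u, (Sum x, e x u) * d u y z * d u y' z') <= C * (D + K).
    (* A zero column also fails [same_class], but then the cross difference vanishes; here the
       weight is small already by [near_secure_marg]. *)
    have zero b w b' w' (U : finType) (e : X -> U -> R) (d : U -> Y -> Z -> R) D K :
       gam b w = 0 -> near_secure e d D K -> 0 <= D -> 0 <= K ->
       (Sum u : U, (Sum x, e x u) * d u b w * d u b' w') <= INR #|X| * c * (D + K).
      move=> g0 ns D0 K0; have := near_secure_marg ns cP b w; rewrite g0 Rminus_0_r => k.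
      apply: Rle_trans (_ : INR #|X| * (c * D) <= _); last first.
        by have := Rmult_le_pos _ _ n0 (Rlt_le _ _ c0); nra.
      apply: Rle_trans k; apply: Rle_trans (Rle_abs _); apply: sumR_le => u.
      have [d0 d1] := ns_d ns u b w; have [d0' d1'] := ns_d ns u b' w'.
      rewrite -[X in _ <= X]Rmult_1_r; apply: Rmult_le_compat_l => //.
      by apply: Rmult_le_pos => //; apply: sumR_ge0 => x; apply: ns_e ns x u.
    case: (Rle_lt_or_eq_dec _ _ (gam_ge0 y z)) => g1; last first.
      exists (INR #|X| * c); first by apply: Rmult_le_pos; lra.
      by move=> U e d D K ns D0 K0 _; apply: zero.
    case: (Rle_lt_or_eq_dec _ _ (gam_ge0 y' z')) => g2; last first.
      exists (INR #|X| * c); first by apply: Rmult_le_pos; lra.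
      move=> U e d D K ns D0 K0 _.
      rewrite (eq_sumR (g := fun u => (Sum x, e x u) * d u y' z' * d u y z)); last by move=> u; ring.
      exact: zero.
    case: (classic (forall x, pZ x y z * gam y' z' = pZ x y' z' * gam y z)) => hs.
      by exists 0; [lra|move=> U e d D K ns D0 K0 []].
    have [x hx] := not_all_ex_not _ _ hs.
    pose r := Rabs (pZ x y z * gam y' z' - pZ x y' z' * gam y z).
    have r0 : 0 < r by apply: Rabs_pos_lt; lra.
    exists (2 * INR #|X| * (INR #|X| * (c ^ 2 * 2)) / r).
      apply: div_ge0; last lra.
      apply: Rmult_le_pos; first lra.
      apply: Rmult_le_pos => //; apply: Rmult_le_pos; [exact: pow_le (Rlt_le _ _ c0)|lra].
    move=> U e d D K ns D0 K0 _; have := near_secure_cross ns c0 cP x y z y' z'.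
    rewrite -/r => k; apply: (Rmult_le_reg_r r) => //; apply: Rle_trans k _.
    by apply: Req_le; field; lra.
  have [C C0 hC] := hm; exists (C + INR #|X| * c) => U e d D K ns D0 K0; split.
    apply: Rle_trans (near_secure_marg ns cP y z) _.
    by have := Rmult_le_pos _ _ C0 D0; nra.
  move=> hs; apply: Rle_trans (hC _ _ _ _ _ ns D0 K0 hs) _.
  apply: Rmult_le_compat_r; first lra.
  by have := Rmult_le_pos _ _ n0 (Rlt_le _ _ c0); lra.
exists C => // U e d D K ns y z.
(* Nonnegativity of D and K is read off from [ns_D] and [ns_K] at a point of [X]; an empty [X]
   contradicts total mass 1. *)
have [[x0 _]|nX] := excluded_middle_informative (exists x : X, True); last first.
  have e0 : 0 = 1.
    by rewrite -p_sum sumR_pair; apply: esym; apply: big1 => x; case: nX; exists x.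
  lra.
have D0 : 0 <= D by apply: Rle_trans (ns_D ns x0 y z); apply: Rabs_pos.
have K0 : 0 <= K by apply: Rle_trans (ns_K ns x0 y z); apply: sumR_ge0 => u; apply: Rabs_pos.
split; first by case: (h ((y, z), (y, z)) _ _ _ _ _ ns D0 K0).
by move=> y' z'; case: (h ((y, z), (y', z')) _ _ _ _ _ ns D0 K0).
Qed.

End OneShot.

(** * Conditional mutual information and continuity of entropy *)

Lemma ln2_gt0 : 0 < ln 2.
Proof. by rewrite -ln_1; apply: ln_increasing; lra. Qed.

Lemma log2_ln x : log2 x * ln 2 = ln x.
Proof. by rewrite /log2; field; have := ln2_gt0; lra. Qed.

Lemma cmi_mutual (A B C : finType) (Q : A -> B -> C -> R) : (forall a b c, 0 <= Q a b c) ->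
  cmi Q * ln 2 = mutual (fun t : A * B * C => Q t.1.1 t.1.2 t.2)
    (fun t => t.1.1) (fun t => t.1.2) (fun t => t.2).
Proof.
move=> Q0; set P := fun t => _.
have P0 t : 0 <= P t by apply: Q0.
have prC c : pr P (fun t => t.2) c = Sum a, Sum b, Q a b c.
  rewrite /pr !sumR_pair; apply: eq_sumR => a; apply: eq_sumR => b.
  exact: (sumR_delta c (fun c => Q a b c)).
have prAC a c : pr P (fun t => (t.1.1, t.2)) (a, c) = Sum b, Q a b c.
  rewrite /pr !sumR_pair /=.
  transitivity (Sum a', if a' == a then Sum b, Q a' b c else 0); last by rewrite sumR_delta.
  apply: eq_sumR => a'; case: eqP => [->|n].
    by apply: eq_sumR => b; rewrite -[RHS](sumR_delta c (fun c => Q a b c)); apply: eq_sumR => c';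
      rewrite xpair_eqE eqxx.
  by apply: sumR0 => b; apply: sumR0 => c'; rewrite xpair_eqE; case: eqP.
have prBC b c : pr P (fun t => (t.1.2, t.2)) (b, c) = Sum a, Q a b c.
  rewrite /pr !sumR_pair /=; apply: eq_sumR => a.
  rewrite -[RHS](sumR_delta b (fun b => Q a b c)); apply: eq_sumR => b'.
  case: eqP => [->|n].
    by rewrite -[RHS](sumR_delta c (fun c => Q a b c)); apply: eq_sumR => c'; rewrite xpair_eqE eqxx.
  by apply: sumR0 => c'; rewrite xpair_eqE; case: eqP.
have prABC a b c : pr P (fun t => (t.1.1, t.1.2, t.2)) (a, b, c) = Q a b c.
  transitivity (Sum t, if t == (a, b, c) then P t else 0); last by rewrite sumR_delta.
  by apply: eq_sumR => -[[a' b'] c'].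
rewrite /mutual !Hrv_E; set E1 := sumR _; set E2 := sumR _; set E3 := sumR _; set E4 := sumR _.
have -> : - E1 + - E2 - - E3 - - E4 = E3 + E4 - E1 - E2 by ring.
rewrite /E1 /E2 /E3 /E4 -sumRD -!sumRB /cmi -sumRZr !sumR_pair.
apply: eq_sumR => a; rewrite -sumRZr; apply: eq_sumR => b; rewrite -sumRZr; apply: eq_sumR => c.
rewrite prABC prC prAC prBC /P /=.
case: Req_EM_T => [e|n0]; first by rewrite /= e; ring.
have q0 : 0 < Q a b c by have := Q0 a b c; lra.
rewrite Rmult_assoc log2_ln.
have h1 := sumR_ge1 b (fun b => Q0 a b c); have h2 := sumR_ge1 a (fun a => Q0 a b c).
have h3 : Q a b c <= Sum a, Sum b, Q a b c.
  have h4 x : 0 <= Sum b, Q x b c by apply: sumR_ge0.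
  by apply: Rle_trans h1 (sumR_ge1 a h4).
rewrite ln_div ?ln_mult; try lra; try ring; apply: Rmult_lt_0_compat; lra.
Qed.

Section ConditionalEntropy.
Variables (O : finType) (P : O -> R).
Hypothesis P0 : forall w, 0 <= P w.

(** As h is a function of g, the difference of the two sides is the mutual information of f and g
    given h. *)
Lemma Hrv_cond_le (A B C : finType) (f : O -> A) (g : O -> B) (h : O -> C) :
  (forall w w', g w = g w' -> h w = h w') ->
  Hrv P (fun w => (f w, g w)) - Hrv P g <= Hrv P (fun w => (f w, h w)) - Hrv P h.
Proof.
move=> gh; have := mutual_ge0 P0 f g h; rewrite /mutual.
rewrite (@Hrv_equiv _ _ _ _ (fun w => (g w, h w)) g).
  rewrite (@Hrv_equiv _ _ _ _ (fun w => (f w, g w, h w)) (fun w => (f w, g w))); first lra.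
  move=> w w'; rewrite !xpair_eqE; case: (eqVneq (g w) (g w')) => [/gh ->|]; last by rewrite !andbF.
  by rewrite eqxx !andbT.
by move=> w w'; rewrite !xpair_eqE; case: (eqVneq (g w) (g w')) => [/gh ->|//]; rewrite eqxx.
Qed.

End ConditionalEntropy.

Lemma ent_dist (A : finType) (f f' : A -> R) (s D : R) :
  (forall t, 0 <= f t <= 1) -> (forall t, 0 <= f' t <= 1) -> 0 < s <= 1 ->
  (Sum t, Rabs (f t - f' t)) <= D -> Rabs (ent f - ent f') <= D * (ln (/ s) + 1) + INR #|A| * s.
Proof.
move=> hf hf' hs hD.
have ls : 0 <= ln (/ s).
  rewrite -ln_1; apply: ln_le_; first lra.
  by rewrite -Rinv_1; apply: Rinv_le_contravar; lra.
have hD' : (Sum t, Rabs (f' t - f t)) <= D.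
  by apply: Rle_trans hD; apply: sumR_le => t; rewrite Rabs_minus_sym; lra.
have k1 := ent_diff hf hf' hs; have k2 := ent_diff hf' hf hs.
by apply: Rabs_le; split; nra.
Qed.

Section Continuity.
Variables (S A : finType) (g : S -> R) (h : S -> A).
Hypotheses (g0 : forall s, 0 <= g s) (g1 : sumR g = 1).

Lemma pr_bounds (O B : finType) (P : O -> R) (k : O -> B) :
  (forall w, 0 <= P w) -> sumR P = 1 -> forall b, 0 <= pr P k b <= 1.
Proof.
move=> P0 P1 b; split; first exact: pr_ge0.
by rewrite -P1 -(sum_pr1 P k); apply: sumR_ge1 => a; apply: pr_ge0.
Qed.

Lemma card_gt0_of_sum : (0 < #|A|)%N.
Proof.
have [s _] : exists s, 0 < g s by apply: sumR_gt0 => //; lra.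
by apply/card_gt0P; exists (h s).
Qed.

(** [ent_dist] at two scales. For one letter [s] is fixed; for blocks the scale a^-n balances the
    alphabet size a^n, so that the error eps (n ln a + 1) + 1 is linear in n. [eps] serves both. *)
Lemma entropy_continuity tau : 0 < tau -> exists2 eps, 0 < eps & exists N : nat,
  forall n, (N <= n)%N -> forall f : seqn S n -> R, (forall s, 0 <= f s) -> sumR f = 1 ->
  (Sum s, Rabs (f s - iid g s)) <= eps ->
  Rabs (Hrv f (mapn h) - INR n * Hrv g h) <= INR n * tau /\
  forall i, Rabs (Hrv f (fun s => h (s i)) - Hrv g h) <= tau.
Proof.
move=> tau0; set a := INR #|A|.
have a1 : 1 <= a by rewrite /a -INR_1; apply/le_INR/leP/card_gt0_of_sum.
have la : 0 <= ln a by rewrite -ln_1; apply: ln_le_; lra.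
pose s := Rmin 1 (tau / (2 * a)).
have s0 : 0 < s by apply: Rmin_glb_lt; [lra|apply: div_gt0; lra].
have s1 : s <= 1 by apply: Rmin_l.
have s2 : a * s <= tau / 2.
  apply: Rle_trans (_ : a * (tau / (2 * a)) <= _).
    by apply: Rmult_le_compat_l; [lra|apply: Rmin_r].
  by apply: Req_le; field; lra.
have ls : 0 <= ln (/ s).
  rewrite -ln_1; apply: ln_le_; first lra.
  by rewrite -Rinv_1; apply: Rinv_le_contravar; lra.
pose eps := (tau / 2) / (ln a + ln (/ s) + 1).
have eps0 : 0 < eps by apply: div_gt0; lra.
have epsE : eps * (ln a + ln (/ s) + 1) = tau / 2 by rewrite /eps; field; lra.
(* n > 2/tau makes the additive 1 of the block estimate at most n tau / 2. *)
exists eps => //; have [N hN] := INR_archimed 1 (2 / tau + 1) Rlt_0_1.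
exists N => n /leP/le_INR Nn f f0 f1 hf.
have i1 : sumR (iid g (n:=n)) = 1 by apply: sum_iid.
have i0 : forall s : seqn S n, 0 <= iid g s by apply: iid_ge0.
have n1 : 1 <= INR n * (tau / 2).
  have e : 2 / tau * (tau / 2) = 1 by field; lra.
  have : 2 / tau * (tau / 2) <= INR n * (tau / 2) by apply: Rmult_le_compat_r; lra.
  lra.
have n2 : 1 <= INR n by have := div_gt0 Rlt_0_2 tau0; lra.
split; last first.
  move=> i; have -> : Hrv g h = Hrv (iid g (n:=n)) (fun s => h (s i)).
    by apply: eq_sumR => t; rewrite pr_iid_coord.
  apply: Rle_trans (ent_dist (pr_bounds _ f0 f1) (pr_bounds _ i0 i1) (conj s0 s1)
    (Rle_trans _ _ _ (pr_dist _ _ _) hf)) _; rewrite -/a; nra.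
have -> : INR n * Hrv g h = Hrv (iid g (n:=n)) (mapn h).
  rewrite /Hrv -(@ent_iid _ n); [|by rewrite sum_pr1|exact: pr_ge0].
  by apply: eq_sumR => t; rewrite pr_iid.
have an : 0 < a ^ n by apply: pow_lt; lra.
have an1 : 0 < / a ^ n <= 1.
  split; first exact: Rinv_0_lt_compat.
  by rewrite -Rinv_1; apply: Rinv_le_contravar; [lra|apply: pow_R1_Rle].
have k := @ent_dist _ _ _ (/ a ^ n) eps (pr_bounds (mapn h) f0 f1)
  (pr_bounds (mapn h) i0 i1) an1 (Rle_trans _ _ _ (pr_dist _ _ _) hf).
apply: Rle_trans k _.
rewrite Rinv_inv ln_pow; last lra.
have -> : INR #|{: seqn A n}| = a ^ n.
  by rewrite card_ffun card_ord /a; elim: (n) => [|k ih] //=; rewrite expnS mult_INR ih.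
rewrite Rinv_r; last lra.
have h1 : eps * 1 <= eps * INR n by apply: Rmult_le_compat_l; lra.
have h2 : 0 <= INR n * eps * ln (/ s) by do 2?apply: Rmult_le_pos; lra.
have h3 : INR n * (eps * (ln a + ln (/ s) + 1)) = INR n * (tau / 2) by rewrite epsE.
lra.
Qed.

End Continuity.

(** * Single-letter laws of a code *)

(** Removes a dummy letter: averaging over it and overwriting it by [a] leaves the functions that
    take the value [a] there. *)
Lemma sum_upd_at (I T : finType) (r : T -> R) i a (F : {ffun I -> T} -> R) : sumR r = 1 ->
  (Sum f : {ffun I -> T}, r (f i) * F (upd f i a)) =
  Sum f : {ffun I -> T}, (if f i == a then F f else 0).
Proof.
move=> r1; rewrite -[RHS](sum_upd i _ r1); apply: eq_sumR => f.
rewrite -[LHS](sumR_delta a (fun b => r (f i) * F (upd f i b))); apply: eq_sumR => b.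
by rewrite updE eqxx; case: eqP => _; ring.
Qed.

Lemma pr_marg (O A B C : finType) (P : O -> R) (f : O -> A) (k : O -> B) (k' : O -> C) F c :
  (forall w a, (k w == F a) = (f w == a) && (k' w == c)) ->
  (Sum a, pr P k (F a)) = pr P k' c.
Proof.
move=> e; rewrite exch_sumR; apply: eq_sumR => w.
rewrite -[RHS](sumR_delta' (f w) (fun=> if k' w == c then P w else 0)).
by apply: eq_sumR => a; rewrite e; case: eqP.
Qed.

(** Compares entropy with t (1 - t), whose sum over the classes is the probability that two
    independent draws differ in class. Above 1/2, eta t <= 1 - t; below, use the tangent at [d] and
    ln (1/d) <= 1/d - 1. *)
Lemma eta_spread t d : 0 <= t <= 1 -> 0 < d <= 1 -> eta t <= d + 2 / d * (t * (1 - t)).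
Proof.
move=> [t0 t1] hd.
have i1 : 1 <= / d by rewrite -Rinv_1; apply: Rinv_le_contravar; lra.
case: (Rle_lt_dec (1 / 2) t) => h.
  have : eta t <= 1 - t.
    have := ln_le_sub1 (Rinv_0_lt_compat t _); rewrite /eta ln_Rinv; try lra.
    move=> /(_ ltac:(lra)) k; have := Rmult_le_compat_l _ _ _ t0 k.
    have -> : t * (/ t - 1) = 1 - t by field; lra.
    lra.
  have : 2 * (t * (1 - t)) <= 2 / d * (t * (1 - t)).
    by apply: Rmult_le_compat_r; [nra|rewrite /Rdiv; lra].
  nra.
have k := eta_le t0 (proj1 hd).
have := ln_le_sub1 (Rinv_0_lt_compat d (proj1 hd)) => l.
have k2 : t * ln (/ d) <= t * / d by apply: Rmult_le_compat_l; lra.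
have : t * / d <= 2 / d * (t * (1 - t)).
  have -> : 2 / d * (t * (1 - t)) = t * / d * (2 * (1 - t)) by rewrite /Rdiv; ring.
  have : 0 <= t * / d by apply: Rmult_le_pos; lra.
  nra.
lra.
Qed.

Section Single.
Variables (X Y Z : finType) (pXY : X -> Y -> R) (pZ : X -> Y -> Z -> R).
Hypothesis p_pos : forall x y, 0 < pXY x y.
Hypothesis p_sum : sumR (fun xy : (X * Y)%type => pXY xy.1 xy.2) = 1.
Hypothesis pZ_pmf : forall x y, is_pmf (pZ x y).

Definition single (s : X * Y * Z) : R := pXY s.1.1 s.1.2 * pZ s.1.1 s.1.2 s.2.

Lemma single_ge0 s : 0 <= single s.
Proof. by apply: Rmult_le_pos; [exact: Rlt_le|case: (pZ_pmf s.1.1 s.1.2)]. Qed.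

Lemma sum_single : sumR single = 1.
Proof.
rewrite sumR_pair -p_sum; apply: eq_sumR => xy; rewrite /single /= sumRZ.
by case: (pZ_pmf xy.1 xy.2) => _ ->; ring.
Qed.

Definition zip3 n (t : seqn X n * seqn Y n * seqn Z n) : seqn (X * Y * Z)%type n :=
  [ffun i => (t.1.1 i, t.1.2 i, t.2 i)].

Lemma zip3_bij n : bijective (@zip3 n).
Proof.
exists (fun s : seqn (X * Y * Z)%type n =>
  ([ffun i => (s i).1.1] : seqn X n, [ffun i => (s i).1.2] : seqn Y n,
   [ffun i => (s i).2] : seqn Z n)) => [[[x y] z]|s].
  by congr (_, _, _); apply/ffunP => i; rewrite !ffunE.
by apply/ffunP => i; rewrite ffunE /= !ffunE; case: (s i) => -[].
Qed.

Section Code.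
Variables (n m : nat) (c : code X Y Z n m).
Hypothesis cv : valid_code c.

Definition outcome := ('I_m * seqn X n * (seqn Y n * seqn Z n))%type.
Definition law (w : outcome) : R := joint pXY c w.1.2 w.2.1 w.1.1 w.2.2.
Definition xyz (w : outcome) : seqn (X * Y * Z)%type n := zip3 (w.1.2, w.2.1, w.2.2).

Lemma enc_ge0 x i : 0 <= enc c x i. Proof. by case: (cv.1 x). Qed.
Lemma dec_ge0 i y z : 0 <= dec c i y z. Proof. by case: (cv.2 i y). Qed.
Lemma sum_enc x : sumR (enc c x) = 1. Proof. by case: (cv.1 x). Qed.
Lemma sum_dec i y : sumR (dec c i y) = 1. Proof. by case: (cv.2 i y). Qed.

Lemma law_ge0 w : 0 <= law w.
Proof.
do 2?apply: Rmult_le_pos; [|exact: enc_ge0|exact: dec_ge0].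
by apply: prodn_ge0 => i; apply: Rlt_le.
Qed.

Lemma sum_law : sumR law = 1.
Proof.
rewrite sumR_pair sumR_pair exch_sumR.
transitivity (Sum x : seqn X n, prodn (fun i => Sum b, pXY (x i) b)).
  apply: eq_sumR => x; rewrite prodn_sum.
  transitivity (Sum i, Sum y, pXYn pXY x y * enc c x i).
    apply: eq_sumR => i; rewrite sumR_pair; apply: eq_sumR => y.
    by rewrite /law /joint /= sumRZ sum_dec Rmult_1_r.
  by rewrite exch_sumR; apply: eq_sumR => y; rewrite sumRZ sum_enc Rmult_1_r.
rewrite -(prodn_sum (fun _ a => Sum b, pXY a b)) (eq_prodn (g := fun=> 1)) ?prodn1 // => i.
by rewrite -p_sum sumR_pair.
Qed.

Lemma pr_xyz t : pr law xyz (zip3 t) = joint_XYZ pXY c t.1.1 t.1.2 t.2.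
Proof.
case: t => -[x y] z; rewrite /pr sumR_pair sumR_pair /joint_XYZ; apply: eq_sumR => i.
have e x' y' z' : (xyz (i, x', (y', z')) == zip3 (x, y, z)) = [&& x' == x, y' == y & z' == z].
  by rewrite /xyz (inj_eq (bij_inj (zip3_bij n))) !xpair_eqE andbA.
transitivity (Sum x', if x' == x then joint pXY c x' y i z else 0); last by rewrite sumR_delta.
apply: eq_sumR => x'; rewrite sumR_pair; case: (eqVneq x' x) => [->|xx]; last first.
  by apply: sumR0 => y'; apply: sumR0 => z'; rewrite e (negbTE xx).
transitivity (Sum y', if y' == y then joint pXY c x y' i z else 0); last by rewrite sumR_delta.
apply: eq_sumR => y'; case: (eqVneq y' y) => [->|yy]; last first.
  by apply: sumR0 => z'; rewrite e (negbTE yy) andbF.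
rewrite -[RHS](sumR_delta z (fun z' => joint pXY c x y i z')).
by apply: eq_sumR => z'; rewrite e !eqxx.
Qed.

Lemma dist_xyz : (Sum s, Rabs (pr law xyz s - iid single s)) = 2 * tv_dist pXY pZ c.
Proof.
rewrite -(reindex_sumR _ (zip3_bij n)) !sumR_pair /tv_dist.
have -> : forall r, 2 * (/ 2 * r) = r by move=> r; field.
apply: eq_sumR => x; apply: eq_sumR => y; apply: eq_sumR => z.
rewrite pr_xyz; congr (Rabs (_ - _)).
by apply: eq_prodn => i; rewrite /zip3 !ffunE.
Qed.

Lemma leak_mutual : leak pXY c * ln 2 =
  mutual law (fun w => w.1.1) (fun w => w.1.2) (fun w => w.2).
Proof. by rewrite /leak cmi_mutual // => a b d; exact: (law_ge0 (a, b, d)). Qed.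

(** I(X_i; U | Y_i, Z_i) with U = (M, Y without the i-th letter): the letter Y_i inside [w.2.1] is
    already in the condition and adds nothing. *)
Definition letter_mutual i : R :=
  mutual law (fun w => w.1.2 i) (fun w => (w.1.1, w.2.1)) (fun w => (w.2.1 i, w.2.2 i)).

(** Each term is at most H(X_i | Y_i, Z_i) - H(X_i | M, Y^n, Z^n). Summed over i, the last entropies
    dominate H(X^n | M, Y^n, Z^n), which is H(X^n | Y^n, Z^n) minus the leakage. *)
Lemma sum_letter_mutual :
  (Sum i, letter_mutual i) <= leak pXY c * ln 2
   + (Sum i, (Hrv law (fun w => xyz w i) - Hrv law (fun w => ((xyz w i).1.2, (xyz w i).2))))
   - (Hrv law xyz - Hrv law (fun w => mapn (fun s => (s.1.2, s.2)) (xyz w))).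
Proof.
have k := Hrv_subadd law_ge0 (fun w => w.1.2) (fun w : outcome => (w.1.1, w.2)).
have e1 : Hrv law xyz = Hrv law (fun w => (w.1.2, w.2)).
  apply: Hrv_equiv => -[[i x] [y z]] [[i' x'] [y' z']] /=.
  by rewrite /xyz (inj_eq (bij_inj (zip3_bij n))) /= !xpair_eqE andbA.
have e2 : Hrv law (fun w => mapn (fun s => (s.1.2, s.2)) (xyz w)) = Hrv law (fun w => w.2).
  apply: Hrv_equiv => -[[i x] [y z]] [[i' x'] [y' z']] /=.
  apply/eqP/eqP => [/ffunP e|[-> ->]]; last by apply/ffunP => j; rewrite !ffunE.
  by congr (_, _); apply/ffunP => j; have := e j; rewrite !ffunE => -[].
have e3 : Hrv law (fun w => (w.1.1, w.1.2, w.2)) = Hrv law (fun w => (w.1.2, (w.1.1, w.2))).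
  by apply: Hrv_equiv => -[[i x] [y z]] [[i' x'] [y' z']]; rewrite !xpair_eqE /=;
    case: (i == i'); case: (x == x').
have kj i : letter_mutual i <= (Hrv law (fun w => xyz w i) -
     Hrv law (fun w => ((xyz w i).1.2, (xyz w i).2))) -
   (Hrv law (fun w => (w.1.2 i, (w.1.1, w.2))) - Hrv law (fun w => (w.1.1, w.2))).
  have := @Hrv_cond_le _ _ law_ge0 _ _ _ (fun w => w.1.2 i) (fun w => (w.1.1, w.2))
    (fun w => ((w.1.1, w.2.1), (w.2.1 i, w.2.2 i))).
  have h : forall w w' : outcome, (w.1.1, w.2) = (w'.1.1, w'.2) ->
     (w.1.1, w.2.1, (w.2.1 i, w.2.2 i)) = (w'.1.1, w'.2.1, (w'.2.1 i, w'.2.2 i)).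
    by move=> w w' [-> ->].
  move=> /(_ h); rewrite /letter_mutual /mutual.
  have -> : Hrv law (fun w => xyz w i) = Hrv law (fun w => (w.1.2 i, (w.2.1 i, w.2.2 i))).
    by apply: Hrv_equiv => w w'; rewrite /xyz /zip3 !ffunE /= !xpair_eqE andbA.
  have -> : Hrv law (fun w => ((xyz w i).1.2, (xyz w i).2)) = Hrv law (fun w => (w.2.1 i, w.2.2 i)).
    by apply: Hrv_equiv => w w'; rewrite /xyz /zip3 !ffunE.
  have -> : Hrv law (fun w => (w.1.2 i, (w.1.1, w.2.1), (w.2.1 i, w.2.2 i))) =
            Hrv law (fun w => (w.1.2 i, (w.1.1, w.2.1, (w.2.1 i, w.2.2 i)))).
    by apply: Hrv_equiv => w w'; rewrite !xpair_eqE -!andbA.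
  have lin p q r s u v : u - v <= q - r -> p + r - q - s <= p - s - (u - v) by lra.
  exact: lin.
apply: Rle_trans (sumR_le kj) _; rewrite [X in X <= _]sumRB.
rewrite leak_mutual /mutual e1 e2 e3.
have lin a e e' c' s1 s2 : c' - a <= s2 -> s1 - s2 <= a + e - c' - e' + s1 - (e - e') by lra.
exact: lin.
Qed.

(** * One letter of a code as an auxiliary variable *)

Section Letter.
Variable i : 'I_n.

Let r (b : Y) : R := Sum x, pXY x b.

Let r_ge0 b : 0 <= r b.
Proof. by apply: sumR_ge0 => x; apply: Rlt_le. Qed.

Let r_sum : sumR r = 1.
Proof. by rewrite -p_sum sumR_pair exch_sumR. Qed.

(* [u.2 i] is a dummy letter with the law of Y, independent of everything else: it fills the place of
   the omitted Y_i. *)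
Definition letter_enc (x : X) (u : 'I_m * seqn Y n) : R :=
  r (u.2 i) * pr (fun xn : seqn X n =>
    prodn (fun j => if j == i then 1 else pXY (xn j) (u.2 j)) * enc c xn u.1) (fun xn => xn i) x.

(** The true letter y overwrites the dummy before decoding, so the dummy never influences the
    output. *)
Definition letter_dec (u : 'I_m * seqn Y n) (y : Y) (z : Z) : R :=
  pr (dec c u.1 (upd u.2 i y)) (fun zn => zn i) z.

Let A x k (yn : seqn Y n) := pr (fun xn => pXYn pXY xn yn * enc c xn k) (fun xn => xn i) x.
Let B k (yn : seqn Y n) z := pr (dec c k yn) (fun zn => zn i) z.

(** The encoder sees X^n only, so Y_i enters through the single factor [pXY x y]: this is the chain
    U - X - Y. *)
Let r_A x y k (yv : seqn Y n) : r (yv i) * A x k (upd yv i y) = pXY x y * letter_enc x (k, yv).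
Proof.
rewrite /A /letter_enc /=.
have -> : forall a b c', a * (b * c') = b * (a * c') by move=> *; ring.
congr (_ * _); rewrite -sumRZ; apply: eq_sumR => xn /=; case: eqP => [e|_]; last ring.
suff -> : pXYn pXY xn (upd yv i y) =
    pXY x y * prodn (fun j => if j == i then 1 else pXY (xn j) (yv j)) by rewrite Rmult_assoc.
rewrite -{1}(prodn_at i (pXY x y)) -prodnM; apply: eq_prodn => j; rewrite updE.
by case: eqP => [->|_]; rewrite ?e ?Rmult_1_l ?Rmult_1_r.
Qed.

Let PABC x b (yz : Y * Z) := pr law
  (fun w => (w.1.2 i, (w.1.1, w.2.1), (w.2.1 i, w.2.2 i))) (x, b, yz).

Let PABC_E x k (yn : seqn Y n) y z :
  PABC x (k, yn) (y, z) = if yn i == y then A x k yn * B k yn z else 0.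
Proof.
rewrite /PABC /pr sumR_pair sumR_pair /=.
transitivity (Sum k', if k' == k then
    (if yn i == y then A x k yn * B k yn z else 0) else 0); last by rewrite sumR_delta.
apply: eq_sumR => k'; case: (eqVneq k' k) => [->|kk]; last first.
  by apply: sumR0 => xn; apply: sumR0 => yz; rewrite !xpair_eqE (negbTE kk) !andbF.
transitivity (Sum xn : seqn X n, if yn i == y then
   (if xn i == x then pXYn pXY xn yn * enc c xn k else 0) * B k yn z
   else 0); last first.
  by rewrite sumR_if sumRZr.
apply: eq_sumR => xn; rewrite sumR_pair.
transitivity (Sum yn', if yn' == yn then (if yn i == y then
   (if xn i == x then pXYn pXY xn yn * enc c xn k else 0) * B k yn z
   else 0) else 0);
  last by rewrite sumR_delta.
apply: eq_sumR => yn'; case: (eqVneq yn' yn) => [->|yy]; last first.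
  by apply: sumR0 => zn; rewrite !xpair_eqE (negbTE yy) !andbF.
rewrite /B -sumRZ -sumR_if; apply: eq_sumR => zn; rewrite !xpair_eqE !eqxx !andbT /law /joint /=.
by case: (xn i == x); case: (yn i == y); case: (zn i == z) => /=; ring.
Qed.

(** Both Markov chains in one identity; the factor r is the law of the dummy letter that fills the
    place of Y_i. *)
Let r_PABC x y z k (yv : seqn Y n) : r (yv i) * PABC x (k, upd yv i y) (y, z) =
  pXY x y * letter_enc x (k, yv) * letter_dec (k, yv) y z.
Proof.
by rewrite PABC_E updE !eqxx -r_A /letter_dec /B /=; ring.
Qed.

Let PABC_0 x k (yn : seqn Y n) y z : yn i != y -> PABC x (k, yn) (y, z) = 0.
Proof. by rewrite PABC_E => /negbTE ->. Qed.

Let PAC x yz := pr law (fun w => (w.1.2 i, (w.2.1 i, w.2.2 i))) (x, yz).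
Let PBC b yz := pr law (fun w => ((w.1.1, w.2.1), (w.2.1 i, w.2.2 i))) (b, yz).
Let PC yz := pr law (fun w => (w.2.1 i, w.2.2 i)) yz.

Let PAC_E x yz : PAC x yz = Sum b, PABC x b yz.
Proof.
rewrite /PAC /PABC; apply: esym.
apply: (@pr_marg _ _ _ _ _ (fun w : outcome => (w.1.1, w.2.1))) => w b.
by rewrite !xpair_eqE; case: (_ == x) => //=; rewrite andbF.
Qed.

Let PBC_E b yz : PBC b yz = Sum x, PABC x b yz.
Proof.
rewrite /PBC /PABC; apply: esym.
apply: (@pr_marg _ _ _ _ _ (fun w : outcome => w.1.2 i)) => w x.
by rewrite !xpair_eqE -!andbA.
Qed.

Let PC_E yz : PC yz = Sum x, PAC x yz.
Proof.
rewrite /PC /PAC; apply: esym.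
exact: (@pr_marg _ _ _ _ _ (fun w : outcome => w.1.2 i)).
Qed.

Let sum_U y (F : 'I_m * seqn Y n -> R) :
  (Sum u : 'I_m * seqn Y n, r (u.2 i) * F (u.1, upd u.2 i y)) =
  Sum u : 'I_m * seqn Y n, if u.2 i == y then F u else 0.
Proof.
rewrite !sumR_pair; apply: eq_sumR => k /=.
by rewrite -(sum_upd_at i y (fun yn => F (k, yn)) r_sum).
Qed.

Let PAC_U x y z : (Sum u, pXY x y * letter_enc x u * letter_dec u y z) = PAC x (y, z).
Proof.
rewrite PAC_E.
transitivity (Sum u : 'I_m * seqn Y n, r (u.2 i) * PABC x (u.1, upd u.2 i y) (y, z)).
  by apply: eq_sumR => -[k yv]; rewrite r_PABC.
rewrite (sum_U y (fun u => PABC x u (y, z))); apply: eq_sumR => -[k yn] /=.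
by case: eqP => [//|/eqP ny]; rewrite PABC_0.
Qed.

Lemma letter_enc_ge0 x u : 0 <= letter_enc x u.
Proof.
apply: Rmult_le_pos => //; apply: pr_ge0 => xn; apply: Rmult_le_pos; last exact: enc_ge0.
by apply: prodn_ge0 => j; case: ifP => _; [lra|exact: Rlt_le].
Qed.

Lemma letter_dec_bounds u y z : 0 <= letter_dec u y z <= 1.
Proof. by apply: pr_bounds; [move=> zn; apply: dec_ge0|apply: sum_dec]. Qed.

(** [ns_K] is conditional Pinsker for [letter_mutual], keeping only the terms with the given x, y,
    z; [d] stays free until [letters_bound]. *)
Lemma letter_near_secure d : 0 < d ->
  near_secure pXY pZ letter_enc letter_dec
    (2 * tv_dist pXY pZ c) (letter_mutual i / (2 * d) + 2 * d).
Proof.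
move=> hd; split.
- exact: letter_enc_ge0.
- exact: letter_dec_bounds.
- move=> y z; rewrite (eq_sumR (fun x => PAC_U x y z)) -PC_E.
  by apply: (pr_bounds _ law_ge0 sum_law _).2.
- move=> x y z; rewrite PAC_U -dist_xyz.
  have -> : PAC x (y, z) = pr (pr law xyz) (fun s => s i) (x, y, z).
    rewrite pr_comp; apply: eq_sumR => w.
    by rewrite /xyz /zip3 ffunE !xpair_eqE /= andbA.
  have -> : pXY x y * pZ x y z = pr (iid single (n:=n)) (fun s => s i) (x, y, z).
    by rewrite (pr_iid_coord sum_single id) /pr sumR_delta.
  have k := pr_dist (pr law xyz) (iid single (n:=n)) (fun s => s i).
  apply: Rle_trans k; set F := fun a => Rabs _.
  apply: (sumR_ge1 (f := F)) => t; exact: Rabs_pos.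
move=> x y z; rewrite PAC_U (eq_sumR (fun x => PAC_U x y z)) -PC_E.
have e u : (Sum x', pXY x' y * letter_enc x' u * letter_dec u y z) =
    r (u.2 i) * PBC (u.1, upd u.2 i y) (y, z).
  by case: u => k yv; rewrite PBC_E -sumRZ; apply: eq_sumR => x'; rewrite r_PABC.
pose G u := Rabs (PABC x u (y, z) - PAC x (y, z) * PBC u (y, z) / PC (y, z)).
(* The dummy weight factors out of the absolute value, so [sum_U] trades the dummies for the blocks
   with Y_i = y. *)
apply: Rle_trans (_ : (Sum u : 'I_m * seqn Y n, r (u.2 i) * G (u.1, upd u.2 i y)) <= _).
  apply: Req_le; apply: eq_sumR => -[k yv]; rewrite e -r_PABC /G /=.
  have lin a b b' c' v : Rabs (a * b - a * b' * (c' / v)) = Rabs a * Rabs (b - c' * b' / v).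
    by rewrite -Rabs_mult; congr Rabs; rewrite /Rdiv; ring.
  by rewrite lin (Rabs_pos_eq (r _)).
rewrite sum_U; apply: Rle_trans (mutual_pinsker law_ge0 _ _ _ sum_law hd).
pose G' a u yz := Rabs (PABC a u yz - PAC a yz * PBC u yz / PC yz).
have G0 a u yz : 0 <= G' a u yz by apply: Rabs_pos.
apply: Rle_trans (_ : (Sum a, Sum b, Sum yz, G' a b yz) <= _); last exact: Rle_refl.
apply: Rle_trans (sumR_ge1 x _); last by move=> a; do 2?apply: sumR_ge0 => ?.
apply: sumR_le => u; apply: Rle_trans (sumR_ge1 (y, z) _); last by [].
by case: ifP => _; [exact: Rle_refl|exact: G0].
Qed.

Let PMY b := pr law (fun w => (w.1.1, w.2.1)) b.

Let PMY_E k (yn : seqn Y n) : PMY (k, yn) = Sum xn, pXYn pXY xn yn * enc c xn k.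
Proof.
rewrite /PMY /pr sumR_pair sumR_pair /=.
transitivity (Sum k', if k' == k then (Sum xn, pXYn pXY xn yn * enc c xn k) else 0);
  last by rewrite sumR_delta.
apply: eq_sumR => k'; case: (eqVneq k' k) => [->|kk]; last first.
  by apply: sumR0 => xn; apply: sumR0 => yz; rewrite xpair_eqE (negbTE kk).
apply: eq_sumR => xn; rewrite sumR_pair.
transitivity (Sum yn', if yn' == yn then pXYn pXY xn yn * enc c xn k else 0);
  last by rewrite sumR_delta.
apply: eq_sumR => yn'; case: (eqVneq yn' yn) => [->|yy]; last first.
  by apply: sumR0 => zn; rewrite xpair_eqE (negbTE yy) andbF.
rewrite -[RHS]Rmult_1_r -(sum_dec k yn) -sumRZ; apply: eq_sumR => zn.
by rewrite xpair_eqE !eqxx.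
Qed.

Let PW_E (W : finType) (cls : Y -> Z -> W) v k (yn : seqn Y n) :
  pr law (fun w => (cls (w.2.1 i) (w.2.2 i), (w.1.1, w.2.1))) (v, (k, yn)) =
  PMY (k, yn) * pr (B k yn) (cls (yn i)) v.
Proof.
rewrite PMY_E pr_comp /pr sumR_pair sumR_pair /=.
set D := sumR (fun w : seqn Z n => _).
transitivity (Sum k', if k' == k then (Sum xn, pXYn pXY xn yn * enc c xn k) * D else 0);
  last by rewrite sumR_delta.
apply: eq_sumR => k'; case: (eqVneq k' k) => [->|kk]; last first.
  by apply: sumR0 => xn; apply: sumR0 => yz; rewrite !xpair_eqE (negbTE kk) andbF.
rewrite -sumRZr; apply: eq_sumR => xn; rewrite sumR_pair.
transitivity (Sum yn', if yn' == yn then pXYn pXY xn yn * enc c xn k * D else 0);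
  last by rewrite sumR_delta.
apply: eq_sumR => yn'; case: (eqVneq yn' yn) => [->|yy]; last first.
  by apply: sumR0 => zn; rewrite !xpair_eqE (negbTE yy) !andbF.
rewrite /D -sumRZ; apply: eq_sumR => zn.
by rewrite !xpair_eqE !eqxx /= andbT; case: ifP => _ //; rewrite Rmult_0_r.
Qed.

Let r_PMY y k (yv : seqn Y n) :
  r (yv i) * PMY (k, upd yv i y) = Sum x, pXY x y * letter_enc x (k, yv).
Proof.
transitivity (Sum x, r (yv i) * A x k (upd yv i y)); last by apply: eq_sumR => x; rewrite r_A.
by rewrite sumRZ sum_pr1 PMY_E.
Qed.

(** Probability that two independent outputs at letter i, given the same message and the same Y^n,
    fall in different classes. *)
Let spread (W : finType) (cls : Y -> Z -> W) (u : 'I_m * seqn Y n) : R :=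
  Sum z, Sum z', if cls (u.2 i) z' == cls (u.2 i) z then 0 else B u.1 u.2 z * B u.1 u.2 z'.

Let B_ge0 k yn z : 0 <= B k yn z.
Proof. by apply: pr_ge0 => zn; apply: dec_ge0. Qed.

Let B_sum k yn : sumR (B k yn) = 1.
Proof. by rewrite sum_pr1 sum_dec. Qed.

(** Given (M, Y^n) the output is independent of X^n, so the conditional law of the class comes from
    [dec] alone; [eta_spread] is then averaged over (M, Y^n). *)
Let cond_entropy_le (W : finType) (cls : Y -> Z -> W) d : 0 < d <= 1 ->
  Hrv law (fun w => (cls (w.2.1 i) (w.2.2 i), (w.1.1, w.2.1))) -
  Hrv law (fun w => (w.1.1, w.2.1)) <=
  INR #|W| * d + 2 / d * Sum u, PMY u * spread cls u.
Proof.
move=> hd; rewrite /Hrv /ent sumR_pair exch_sumR -sumRB.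
have P0 u : 0 <= PMY u by apply: pr_ge0 => w; apply: law_ge0.
have -> : INR #|W| * d + 2 / d * (Sum u, PMY u * spread cls u) =
   Sum u, PMY u * (INR #|W| * d + 2 / d * spread cls u).
  transitivity (Sum u, PMY u * (INR #|W| * d) + 2 / d * (PMY u * spread cls u)).
    rewrite sumRD sumRZ sumRZr sum_pr1 sum_law; ring.
  by apply: eq_sumR => u; ring.
apply: sumR_le => -[k yn]; rewrite -/(PMY (k, yn)).
under eq_sumR => v do rewrite PW_E.
set p := PMY _; pose D v := pr (B k yn) (cls (yn i)) v.
have D0 v : 0 <= D v by apply: pr_ge0.
have D1 : sumR D = 1 by rewrite sum_pr1 B_sum.
have etaM a b : 0 <= a -> 0 <= b -> eta (a * b) = b * eta a + a * eta b.
  move=> [a0|<-] [b0|<-]; rewrite /eta ?Rmult_0_l ?Rmult_0_r; try ring.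
  by rewrite ln_mult //; ring.
have -> : (Sum v, eta (p * D v)) - eta p = p * Sum v, eta (D v).
  have -> : (Sum v, eta (p * D v)) = Sum v, (D v * eta p + p * eta (D v)).
    by apply: eq_sumR => v; apply: etaM; [exact: P0|exact: D0].
  by rewrite sumRD sumRZr sumRZ D1; ring.
apply: Rmult_le_compat_l; first exact: P0.
have -> : spread cls (k, yn) = Sum v, D v * (1 - D v).
  rewrite (sum_pr (B k yn) (cls (yn i)) (fun v => 1 - D v)); apply: eq_sumR => z.
  rewrite -{1}(B_sum k yn) -sumRB -sumRZ /=; apply: eq_sumR => z'.
  by case: ifP => _; ring.
rewrite -sumR_const -sumRZ -sumRD; apply: sumR_le => v; apply: eta_spread => //.
by split => //; rewrite -D1; apply: sumR_ge1.
Qed.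

(** Sort u by the value y of its i-th letter; pXY x y <= 1 then reduces to the y-free weights of the
    separation lemma. *)
Let spread_U (W : finType) (cls : Y -> Z -> W) b : 0 <= b ->
  (forall y z z', cls y z' != cls y z ->
    (Sum u, (Sum x, letter_enc x u) * letter_dec u y z * letter_dec u y z') <= b) ->
  (Sum u, PMY u * spread cls u) <= INR #|Y| * (INR #|Z| * (INR #|Z| * b)).
Proof.
move=> b0 hb.
have -> : (Sum u, PMY u * spread cls u) =
    Sum y, Sum u : 'I_m * seqn Y n, if u.2 i == y then PMY u * spread cls u else 0.
  by rewrite exch_sumR; apply: eq_sumR => u; rewrite sumR_delta'.
rewrite -sumR_const; apply: sumR_le => y; rewrite -(sum_U y (fun u => PMY u * spread cls u)).
apply: Rle_trans (_ : (Sum z, Sum z', Sum u, if cls y z' == cls y z then 0 else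
    (Sum x, letter_enc x u) * letter_dec u y z * letter_dec u y z') <= _); last first.
  rewrite -sumR_const; apply: sumR_le => z; rewrite -sumR_const; apply: sumR_le => z'.
  by case: (eqVneq (cls y z') (cls y z)) => h; [rewrite sumR0|exact: hb].
under [X in _ <= X]eq_sumR => z do rewrite exch_sumR.
rewrite exch_sumR; apply: sumR_le => -[k yv].
rewrite -Rmult_assoc r_PMY.
apply: Rle_trans (_ : (Sum x, letter_enc x (k, yv)) * spread cls (k, upd yv i y) <= _).
  apply: Rmult_le_compat_r.
    do 2?apply: sumR_ge0 => ?; case: ifP => _; first lra.
    by apply: Rmult_le_pos; apply: B_ge0.
  apply: sumR_le => x; rewrite -[X in _ <= X]Rmult_1_l; apply: Rmult_le_compat_r.
    exact: letter_enc_ge0.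
  exact: p_le1.
rewrite -sumRZ; apply: sumR_le => z; rewrite -sumRZ; apply: sumR_le => z' /=.
rewrite updE eqxx; case: ifP => _; first lra.
by rewrite /letter_dec /B /=; lra.
Qed.

Lemma letter_class_entropy (W : finType) (cls : Y -> Z -> W) d b : 0 < d <= 1 -> 0 <= b ->
  (forall y z z', cls y z' != cls y z ->
    (Sum u, (Sum x, letter_enc x u) * letter_dec u y z * letter_dec u y z') <= b) ->
  Hrv law (fun w => (cls (w.2.1 i) (w.2.2 i), (w.1.1, w.2.1))) -
  Hrv law (fun w => (w.1.1, w.2.1)) <=
  INR #|W| * d + 2 / d * (INR #|Y| * (INR #|Z| * (INR #|Z| * b))).
Proof.
move=> hd b0 hb; apply: Rle_trans (cond_entropy_le cls hd) _.
apply: Rplus_le_compat_l; apply: Rmult_le_compat_l; first by apply: div_ge0; lra.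
exact: spread_U.
Qed.

End Letter.

End Code.
End Single.

(** * Converse: the classes do not depend on y *)

Lemma Hrv_pr (O A B : finType) (P : O -> R) (f : O -> A) (g : A -> B) :
  Hrv (pr P f) g = Hrv P (fun w => g (f w)).
Proof. by apply: eq_sumR => b; rewrite pr_comp. Qed.

Lemma ln2_le1 : ln 2 <= 1.
Proof. by have := ln_le_sub1 Rlt_0_2; lra. Qed.

Definition holds (A : Prop) : bool := if excluded_middle_informative A then true else false.

Lemma holdsP A : reflect A (holds A).
Proof. by rewrite /holds; case: excluded_middle_informative => h; constructor. Qed.

Lemma le_of_le_eps a b c : 0 <= c -> (forall e, 0 < e -> a <= b + c * e) -> a <= b.
Proof.
move=> c0 h; apply: Rnot_lt_le => ba.
have e0 : 0 < (a - b) / (2 * (c + 1)) by apply: div_gt0; lra.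
have := h _ e0.
have : (c + 1) * ((a - b) / (2 * (c + 1))) = (a - b) / 2 by field; lra.
lra.
Qed.

Lemma Rabs_def2_le a b : Rabs a <= b -> - b <= a <= b.
Proof. by move=> h; have := Rle_abs a; have := Rle_abs (- a); rewrite Rabs_Ropp; lra. Qed.

Section Converse.
Variables (X Y Z : finType) (pXY : X -> Y -> R) (pZ : X -> Y -> Z -> R).
Hypothesis p_pos : forall x y, 0 < pXY x y.
Hypothesis p_sum : sumR (fun xy : (X * Y)%type => pXY xy.1 xy.2) = 1.
Hypothesis pZ_pmf : forall x y, is_pmf (pZ x y).

Local Notation single := (single pXY pZ).
Local Notation gam := (gam pZ).
Local Notation same_class := (same_class pZ).

Let s0 s : 0 <= single s. Proof. exact: single_ge0. Qed.
Let s1 : sumR single = 1. Proof. exact: sum_single. Qed.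

Lemma code_continuity (A : finType) (h : X * Y * Z -> A) tau : 0 < tau ->
  exists2 eps, 0 < eps & exists N : nat, forall n, (N <= n)%N ->
  forall m (c : code X Y Z n m), valid_code c -> tv_dist pXY pZ c <= eps ->
  Rabs (Hrv (law pXY c) (fun w => mapn h (xyz w)) - INR n * Hrv single h) <= INR n * tau /\
  forall i, Rabs (Hrv (law pXY c) (fun w => h (xyz w i)) - Hrv single h) <= tau.
Proof.
move=> t0; have [eps e0 [N hN]] := entropy_continuity h s0 s1 t0.
(* [tv_dist] is half of the L1 distance. *)
exists (eps / 2); first lra.
exists N => n Nn m c cv tv.
have := hN n Nn (pr (law pXY c) (@xyz X Y Z n m)).
case.
- by apply: pr_ge0; apply: law_ge0.
- by rewrite sum_pr1 sum_law.
- by rewrite dist_xyz //; lra.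
rewrite (Hrv_pr (law pXY c) (@xyz X Y Z n m) (mapn h)) => k1 k2; split => // i.
by rewrite -(Hrv_pr (law pXY c) (@xyz X Y Z n m) (fun s => h (s i))).
Qed.

Lemma letter_mutual_small tau : 0 < tau -> exists2 eps, 0 < eps & exists N : nat,
  forall n, (N <= n)%N -> forall m (c : code X Y Z n m), valid_code c ->
  tv_dist pXY pZ c <= eps -> leak pXY c <= INR n * eps ->
  (Sum i, letter_mutual pXY c i) <= INR n * tau.
Proof.
(* Five errors of n tau / 5 each: the leakage, two sums of one-letter entropies, two block
   entropies. *)
move=> t0; have t5 : 0 < tau / 5 by lra.
have [e1 e10 [N1 h1]] := code_continuity id t5.
have [e2 e20 [N2 h2]] := code_continuity (fun s => (s.1.2, s.2)) t5.
exists (Rmin (tau / 5) (Rmin e1 e2)); first by do 2?apply: Rmin_glb_lt.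
exists (maxn N1 N2) => n; rewrite geq_max => /andP [n1 n2] m c cv tv lk.
have m1 := Rmin_l (tau / 5) (Rmin e1 e2); have m2 := Rmin_r (tau / 5) (Rmin e1 e2).
have m3 := Rmin_l e1 e2; have m4 := Rmin_r e1 e2.
have [k1 l1] := h1 n n1 m c cv (ltac:(lra)).
have [k2 l2] := h2 n n2 m c cv (ltac:(lra)).
apply: Rle_trans (sum_letter_mutual p_pos cv) _.
have e : Hrv (law pXY c) (fun w => mapn id (xyz w)) = Hrv (law pXY c) (@xyz X Y Z n m).
  by apply: Hrv_equiv => w w'; congr (_ == _); apply/ffunP => i; rewrite ffunE.
rewrite e in k1.
set a := Hrv single _ in k1 l1; set b := Hrv single _ in k2 l2.
set p := Hrv _ _ in k1; set q := Hrv _ _ in k2.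
have k3 : (Sum i, Hrv (law pXY c) (fun w => xyz w i) -
    Hrv (law pXY c) (fun w => ((xyz w i).1.2, (xyz w i).2))) <= INR n * (a - b + 2 * (tau / 5)).
  rewrite -sumR_ord_const; apply: sumR_le => i.
  have := l1 i; have := l2 i.
  set u := Hrv _ _; set v := Hrv _ _ => /Rabs_def2_le hu /Rabs_def2_le hv.
  lra.
have lk' : leak pXY c * ln 2 <= INR n * (tau / 5).
  have n0 : 0 <= INR n by apply: pos_INR.
  have := ln2_gt0; have := ln2_le1 => l l'.
  have h : INR n * Rmin (tau / 5) (Rmin e1 e2) <= INR n * (tau / 5) by apply: Rmult_le_compat_l.
  have h' : 0 <= INR n * (tau / 5) by apply: Rmult_le_pos; lra.
  case: (Rle_lt_dec (leak pXY c) 0) => z; nra.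
move: k1 k2 => /Rabs_def2_le k1 /Rabs_def2_le k2.
have lin l S1 (nn aa bb tt pp qq : R) : S1 <= nn * (aa - bb + 2 * (tt / 5)) -> l <= nn * (tt / 5) ->
  - (nn * (tt / 5)) <= pp - nn * aa <= nn * (tt / 5) ->
  - (nn * (tt / 5)) <= qq - nn * bb <= nn * (tt / 5) -> l + S1 - (pp - qq) <= nn * tt by lra.
exact: lin k3 lk' k1 k2.
Qed.

(* On average over the letters, same-message outputs of different classes have weight at most [b]. *)
Lemma letters_bound b : 0 < b -> exists2 eps, 0 < eps & exists N : nat,
  forall n, (N <= n)%N -> forall m (c : code X Y Z n m), valid_code c ->
  tv_dist pXY pZ c <= eps -> leak pXY c <= INR n * eps ->
  exists bi : 'I_n -> R, [/\ forall i, 0 <= bi i, sumR bi <= INR n * b &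
  forall i y z,
  Rabs ((Sum u, (Sum x, letter_enc pXY c i x u) * letter_dec c i u y z) - gam y z) <= bi i /\
  forall y' z', ~ same_class y z y' z' ->
    (Sum u, (Sum x, letter_enc pXY c i x u) * letter_dec c i u y z *
       letter_dec c i u y' z') <= bi i].
Proof.
move=> b0; have [C C0 hC] := near_secure_separation p_pos p_sum pZ_pmf.
(* These choices make 2 C d, the average over the letters of C [letter_mutual] / (2 d), and 2 C
   [tv_dist] at most b/4 each. *)
pose d := b / (8 * C); have d0 : 0 < d by apply: div_gt0; lra.
pose tau := b * (2 * d) / (4 * C); have t0 : 0 < tau by apply: div_gt0; nra.
have [e1 e10 [N hN]] := letter_mutual_small t0.
have e20 : 0 < b / (8 * C) by apply: div_gt0; lra.
exists (Rmin e1 (b / (8 * C))); first exact: Rmin_glb_lt.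
exists N => n Nn m c cv tv lk.
have m1 := Rmin_l e1 (b / (8 * C)); have m2 := Rmin_r e1 (b / (8 * C)).
have n0 : 0 <= INR n by apply: pos_INR.
have lk' : leak pXY c <= INR n * e1.
  by apply: Rle_trans lk _; apply: Rmult_le_compat_l.
have hJ := hN n Nn m c cv (ltac:(lra)) lk'.
pose K i := letter_mutual pXY c i / (2 * d) + 2 * d.
have K0 i : 0 <= K i.
  apply: Rplus_le_le_0_compat; last lra.
  by apply: div_ge0; [apply: mutual_ge0; apply: law_ge0|lra].
have D0 : 0 <= 2 * tv_dist pXY pZ c.
  by rewrite -dist_xyz //; apply: sumR_ge0 => s; apply: Rabs_pos.
exists (fun i => C * (2 * tv_dist pXY pZ c + K i)); split.
- by move=> i; apply: Rmult_le_pos; have := K0 i; lra.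
- rewrite sumRZ sumRD sumR_const card_ord /K sumRD sumR_const card_ord /Rdiv sumRZr.
  have h1 : C * (2 * tv_dist pXY pZ c) <= b / 4.
    have -> : b / 4 = C * (2 * (b / (8 * C))) by field; lra.
    by apply: Rmult_le_compat_l; lra.
  have h2 : C * ((Sum i, letter_mutual pXY c i) * / (2 * d)) <= INR n * (b / 4).
    have -> : INR n * (b / 4) = C * (INR n * tau * / (2 * d)) by rewrite /tau; field; lra.
    apply: Rmult_le_compat_l; first lra.
    by apply: Rmult_le_compat_r => //; apply/Rlt_le/Rinv_0_lt_compat; lra.
  have h3 : C * (2 * d) = b / 4 by rewrite /d; field; lra.
  move: h1 h2 h3; set t := tv_dist _ _ _; set J := sumR _ * _ => h1 h2 h3.
  have h4 : INR n * (C * (2 * t)) <= INR n * (b / 4) by apply: Rmult_le_compat_l.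
  have h5 : INR n * (C * (2 * d)) = INR n * (b / 4) by rewrite h3.
  have h6 : 0 <= INR n * b by apply: Rmult_le_pos; lra.
  lra.
move=> i y z; have ns := letter_near_secure p_pos p_sum pZ_pmf cv i d0.
have [k1 k2] := hC _ _ _ _ _ ns y z; split => //.
by apply: Rle_trans k1 _; apply: Rmult_le_compat_l; have := K0 i; lra.
Qed.

Lemma same_class_sym y z y' z' : same_class y z y' z' -> same_class y' z' y z.
Proof. by case=> h1 h2 h; split => // x; rewrite h. Qed.

Lemma same_class_trans y z y' z' y2 z2 :
  same_class y z y' z' -> same_class y' z' y2 z2 -> same_class y z y2 z2.
Proof.
case=> h1 h2 h [h3 h4 h']; split => // x.
apply: (Rmult_eq_reg_r (gam y' z')); last lra.
transitivity (pZ x y z * gam y' z' * gam y2 z2); first ring.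
transitivity (pZ x y' z' * gam y2 z2 * gam y z); last by rewrite h'; ring.
by rewrite h; ring.
Qed.

(** Equals P(W = v | X = x, Y = y) / alpha_v(x) for the class v of (y0,z0), wherever alpha_v(x) > 0;
    its constancy in y is what lets Alice draw the class alone. *)
Definition class_weight y0 z0 y := Sum z, if holds (same_class y0 z0 y z) then gam y z else 0.

Lemma XY_inhabited : exists (x : X) (y : Y), True.
Proof.
have [|[x y] _] := @sumR_gt0 _ (fun xy : X * Y => pXY xy.1 xy.2)
  (fun t => Rlt_le _ _ (p_pos t.1 t.2)).
  by rewrite p_sum; lra.
by exists x, y.
Qed.

(** A transport argument: run the decoder at y and at y' with the same u. The joint weight [q] has
    marginals close to [gam y] and [gam y'] and little weight on pairs of different classes, so no
    class can lose weight from y to y'. *)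
Lemma class_weight_const Rt : achievable pXY pZ Rt ->
  forall y0 z0 y y', class_weight y0 z0 y = class_weight y0 z0 y'.
Proof.
case=> msz [c [cP cA]] y0 z0.
suff le y y' : class_weight y0 z0 y <= class_weight y0 z0 y' by move=> y y'; apply: Rle_antisym.
pose nZ := INR #|Z|; have nZ0 : 0 <= nZ by apply: pos_INR.
(* nZ b for each of the two marginals, nZ^2 b for the pairs of different classes. *)
apply: (@le_of_le_eps _ _ (2 * nZ + nZ * nZ)) => [|b b0]; first nra.
have [eps e0 [N hN]] := letters_bound b0.
have [N' hN'] := cA eps e0.
pose n := (maxn (maxn N N') 1).
have [tv lk] := hN' n ltac:(by rewrite /n !leq_max leqnn orbT).
have cv : valid_code (c n) by case: (cP n).
have [bi [bi0 hbi hs]] := hN n ltac:(by rewrite /n !leq_max leqnn) _ _ cv tv lk.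
have n1 : (0 < n)%N by rewrite /n leq_max orbT.
(* Some letter does no worse than the average; the 1 in the definition of [n] guarantees that there
   is a letter. *)
have [i hi] : exists i, bi i <= b.
  apply: NNPP => nex.
  have h i : b < bi i by apply: Rnot_le_lt => h; apply: nex; exists i.
  have : (Sum i : 'I_n, b) < sumR bi.
    pose i0 := Ordinal n1.
    have : 0 < Sum i, bi i - b.
      apply: Rlt_le_trans (sumR_ge1 i0 _); first by have := h i0; lra.
      by move=> i; have := h i; lra.
    by rewrite sumRB sumR_ord_const; lra.
  by rewrite sumR_ord_const; lra.
pose e u := Sum x, letter_enc pXY (c n) i x u; pose dd := letter_dec (c n) i.
have {}hs y1 z : Rabs ((Sum u, e u * dd u y1 z) - gam y1 z) <= bi i /\
  forall y2 z', ~ same_class y1 z y2 z' -> (Sum u, e u * dd u y1 z * dd u y2 z') <= bi i.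
  exact: hs.
have S0 u : 0 <= e u by apply: sumR_ge0 => x; apply: letter_enc_ge0.
have d0 u y1 z : 0 <= dd u y1 z by case: (letter_dec_bounds cv i u y1 z).
have d1 u y1 : (Sum z, dd u y1 z) = 1 by rewrite sum_pr1 sum_dec.
pose q z z' := Sum u, e u * dd u y z * dd u y' z'.
have q0 z z' : 0 <= q z z' by apply: sumR_ge0 => u; do 2?apply: Rmult_le_pos.
have q1 z : (Sum z', q z z') = Sum u, e u * dd u y z.
  by rewrite exch_sumR; apply: eq_sumR => u; rewrite sumRZ d1; ring.
have q2 z' : (Sum z, q z z') = Sum u, e u * dd u y' z'.
  rewrite exch_sumR; apply: eq_sumR => u.
  rewrite (eq_sumR (g := fun z => e u * dd u y' z' * dd u y z)); last by move=> z; ring.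
  by rewrite sumRZ d1; ring.
have g1 z : gam y z <= (Sum z', q z z') + b.
  by rewrite q1; have [/Rabs_def2_le k _] := hs y z; lra.
have g2 z' : (Sum z, q z z') <= gam y' z' + b.
  by rewrite q2; have [/Rabs_def2_le k _] := hs y' z'; lra.
pose A z := holds (same_class y0 z0 y z); pose A' z := holds (same_class y0 z0 y' z).
apply: Rle_trans (_ : (Sum z, ((Sum z', (if A' z' then q z z' else 0)) + (nZ * b + b))) <= _).
  apply: sumR_le => z; rewrite -/(A z).
  have w0 : 0 <= Sum z', (if A' z' then q z z' else 0).
    by apply: sumR_ge0 => z'; case: ifP => _; [exact: q0|lra].
  case: (boolP (A z)) => [Az|_]; last by nra.
  apply: Rle_trans (g1 z) _; rewrite -Rplus_assoc; apply: Rplus_le_compat_r.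
  rewrite /nZ -sumR_const -sumRD; apply: sumR_le => z'.
  case: (boolP (A' z')) => [_|/holdsP nA]; first lra.
  rewrite Rplus_0_l; apply: Rle_trans hi; have [_ k] := hs y z; apply: k => sc.
  by apply: nA; apply: same_class_trans sc; apply/holdsP.
rewrite sumRD sumR_const -/nZ exch_sumR.
suff h : (Sum z', Sum z, if A' z' then q z z' else 0) <= class_weight y0 z0 y' + nZ * b by lra.
rewrite /nZ -sumR_const -sumRD; apply: sumR_le => z'; rewrite sumR_if -/(A' z').
by case: ifP => _; [exact: g2|lra].
Qed.

End Converse.

(** * The class structure *)

(** [cs_inj] keeps distinct classes apart and [cs_mass] carries the independence of y; on a zero
    column [cls] is arbitrary, as [cs_fact] then reads 0 = 0. *)
Record class_structure (X Y Z W : finType) (pZ : X -> Y -> Z -> R)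
    (alpha : W -> X -> R) (cls : Y -> Z -> W) (mass : W -> R) : Prop := ClassStructure {
  cs_pmf : forall v, is_pmf (alpha v);
  cs_inj : forall v v', (forall x, alpha v x = alpha v' x) -> v = v';
  cs_fact : forall x y z, pZ x y z = alpha (cls y z) x * gam pZ y z;
  cs_mass : forall v y, (Sum z, if cls y z == v then gam pZ y z else 0) = mass v;
  cs_pos : forall v, 0 < mass v }.

Section Structure.
Variables (X Y Z : finType) (pXY : X -> Y -> R) (pZ : X -> Y -> Z -> R).
Hypothesis p_pos : forall x y, 0 < pXY x y.
Hypothesis p_sum : sumR (fun xy : (X * Y)%type => pXY xy.1 xy.2) = 1.
Hypothesis pZ_pmf : forall x y, is_pmf (pZ x y).

Local Notation gam := (gam pZ).
Local Notation same_class := (same_class pZ).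

Let g0 y z : 0 <= gam y z. Proof. exact: gam_ge0. Qed.

Lemma gam_eq0 x y z : gam y z = 0 -> pZ x y z = 0.
Proof.
move=> e; apply: (sumR_eq0 (f := fun x => pZ x y z)) => // x'.
by case: (pZ_le1 pZ_pmf x' y z).
Qed.

Lemma same_class_ex y z y' :
  (forall y1 y2, class_weight pZ y z y1 = class_weight pZ y z y2) ->
  0 < gam y z -> exists z', same_class y z y' z'.
Proof.
move=> wc h.
have nn y1 z' : 0 <= if holds (same_class y z y1 z') then gam y1 z' else 0.
  by case: ifP => _; [exact: g0|lra].
have : 0 < class_weight pZ y z y'.
  rewrite (wc y' y); apply: Rlt_le_trans (sumR_ge1 z (nn y)).
  by case: holdsP => // -[].
by case/(sumR_gt0 (nn y')) => z'; case: holdsP => [sc _|_]; [exists z'|lra].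
Qed.

(** Classes are named by canonical representatives at one reference letter [y0]; constancy of
    [class_weight] provides one for each nonzero column at any y. *)
Lemma class_structure_exists :
  (forall y z y1 y2, class_weight pZ y z y1 = class_weight pZ y z y2) ->
  exists k (alpha : 'I_k -> X -> R) (cls : Y -> Z -> 'I_k) (mass : 'I_k -> R),
  class_structure pZ alpha cls mass.
Proof.
move=> wc; have [x0 [y0 _]] := XY_inhabited p_pos p_sum.
have [z0 hz0] : exists z, 0 < gam y0 z.
  apply: sumR_gt0; first exact: g0.
  rewrite exch_sumR (eq_sumR (g := fun=> 1)); last by move=> x; case: (pZ_pmf x y0).
  rewrite sumR_const Rmult_1_r; apply/lt_0_INR/ltP/card_gt0P; by exists x0.
(* [pick] depends only on the predicate, so equivalent columns receive the same representative. *)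
pose rep y z := [pick z' | holds (same_class y z y0 z')].
have rep_eq y z y' z' : same_class y z y' z' -> rep y z = rep y' z'.
  move=> sc; apply: eq_pick => z2; apply/holdsP/holdsP => h.
    exact: same_class_trans (same_class_sym sc) h.
  exact: same_class_trans sc h.
have repP y z : 0 < gam y z -> exists2 z', rep y z = Some z' & same_class y z y0 z'.
  move=> h; rewrite /rep; case: pickP => [z' /holdsP sc|n]; first by exists z'.
  have [z' sc] := same_class_ex y0 (wc y z) h.
  by have := n z'; case: holdsP.
have [zc rc sc0] := repP _ _ hz0.
pose canon := [set z | holds (0 < gam y0 z) && (rep y0 z == Some z)].
(* [zc] is the default for z outside Z^(y), which has no representative. *)
pose rep1 y z := odflt zc (rep y z).
have zcP : zc \in canon.
  rewrite inE (rep_eq _ _ _ _ (same_class_sym sc0)) rc eqxx andbT; apply/holdsP; by case: sc0.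
have rep1P y z : 0 < gam y z -> same_class y z y0 (rep1 y z) /\ rep1 y z \in canon.
  move=> h; have [z' e sc] := repP _ _ h; rewrite /rep1 e /=; split => //.
  rewrite inE (rep_eq _ _ _ _ (same_class_sym sc)) e eqxx andbT; apply/holdsP; by case: sc.
have rep1C y z : rep1 y z \in canon.
  case: (Rle_lt_or_eq_dec _ _ (g0 y z)) => h; first by case: (rep1P _ _ h).
  rewrite /rep1 /rep; case: pickP => [z' /holdsP [h']|//]; lra.
pose alpha (i : 'I_#|canon|) x := pZ x y0 (enum_val i) / gam y0 (enum_val i).
pose cls y z := enum_rank_in zcP (rep1 y z).
have clsK y z : enum_val (cls y z) = rep1 y z by apply: enum_rankK_in.
have canonP (i : 'I_#|canon|) : 0 < gam y0 (enum_val i) /\ rep y0 (enum_val i) = Some (enum_val i).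
  by have := enum_valP i; rewrite inE => /andP [/holdsP h /eqP].
have same_cls (i : 'I_#|canon|) y z :
    same_class y0 (enum_val i) y z <-> (0 < gam y z /\ cls y z = i).
  split=> [sc|[h <-]]; last by rewrite clsK; apply: same_class_sym; case: (rep1P _ _ h).
  split; first by case: sc.
  apply: enum_val_inj; rewrite clsK /rep1 -(rep_eq _ _ _ _ sc).
  by have [_ ->] := canonP i.
exists #|canon|, alpha, cls, (fun i => class_weight pZ y0 (enum_val i) y0); split.
- move=> i; have [h _] := canonP i; split.
    by move=> x; apply: div_ge0; [case: (pZ_le1 pZ_pmf x y0 (enum_val i))|lra].
  by rewrite /alpha /Rdiv sumRZr -/(gam y0 (enum_val i)) Rinv_r; lra.
- move=> i j e; have [hi ri] := canonP i; have [hj rj] := canonP j.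
  have sc : same_class y0 (enum_val i) y0 (enum_val j).
    split => // x; have := e x; rewrite /alpha => ex.
    transitivity (pZ x y0 (enum_val i) / gam y0 (enum_val i) *
      (gam y0 (enum_val i) * gam y0 (enum_val j))).
      by field; lra.
    by rewrite ex; field; lra.
  by apply: enum_val_inj; have := rep_eq _ _ _ _ sc; rewrite ri rj => -[].
- move=> x y z; rewrite /alpha clsK.
  case: (Rle_lt_or_eq_dec _ _ (g0 y z)) => h; last by rewrite -h gam_eq0 //; ring.
  have [[_ h' hx] _] := rep1P _ _ h.
  transitivity (pZ x y0 (rep1 y z) * gam y z / gam y0 (rep1 y z)); last by rewrite /Rdiv; ring.
  by rewrite -hx; field; lra.
- move=> i y; rewrite (wc y0 (enum_val i) y0 y); apply: eq_sumR => z.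
  case: (Rle_lt_or_eq_dec _ _ (g0 y z)) => h; last by rewrite -h; case: ifP; case: ifP.
  case: holdsP => [/same_cls [_ ->]|n]; first by rewrite eqxx.
  by case: eqP => // e; case: n; apply/same_cls.
move=> i; have [h _] := canonP i.
have nn z' : 0 <= if holds (same_class y0 (enum_val i) y0 z') then gam y0 z' else 0.
  by case: ifP => _; [exact: g0|lra].
apply: Rlt_le_trans (sumR_ge1 (enum_val i) nn).
by case: holdsP => // -[].
Qed.

End Structure.

(** * From the class structure to the notions of the theorem *)

Section Consistent.
Variables (X Y Z : finType) (pXY : X -> Y -> R) (pZ : X -> Y -> Z -> R).
Hypothesis p_pos : forall x y, 0 < pXY x y.
Hypothesis p_sum : sumR (fun xy : (X * Y)%type => pXY xy.1 xy.2) = 1.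
Hypothesis pZ_pmf : forall x y, is_pmf (pZ x y).

Local Notation single := (single pXY pZ).
Local Notation gam := (gam pZ).

Lemma inZy_gam y z : inZy pZ y z <-> 0 < gam y z.
Proof.
split=> [[x h]|h].
  apply: Rlt_le_trans h (sumR_ge1 (f := fun x => pZ x y z) x _) => x'.
  by case: (pZ_le1 pZ_pmf x' y z).
by apply: sumR_gt0 h => x; case: (pZ_le1 pZ_pmf x y z).
Qed.

Lemma consistent_of_structure k (alpha : 'I_k -> X -> R) cls mass :
  class_structure pZ alpha cls mass -> consistent_classes pZ.
Proof.
move=> cs; exists k, alpha; split; first exact: cs_pmf cs.
move=> y; split=> [z /inZy_gam h|i].
  exists (cls y z); split.
    by exists (gam y z); split => // x; rewrite (cs_fact cs) Rmult_comm.
  move=> j [a [a0 ha]]; apply: (cs_inj cs) => x.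
  have [_ sj] := cs_pmf cs j.
  have e : (Sum x, pZ x y z) = a by rewrite (eq_sumR ha) sumRZ sj Rmult_1_r.
  rewrite -/(gam y z) in e.
  apply: (Rmult_eq_reg_r (gam y z)); last lra.
  by rewrite -(cs_fact cs) ha e; ring.
have nn z : 0 <= if cls y z == i then gam y z else 0.
  by case: ifP => _; [exact: gam_ge0|lra].
have := cs_pos cs i; rewrite -(cs_mass cs i y) => /(sumR_gt0 nn) [z].
case: eqP => [e h|_]; last lra.
exists z; split; first exact/inZy_gam.
by exists (gam y z); split => // x; rewrite (cs_fact cs) e Rmult_comm.
Qed.

Section Indexed.
Variables (W : finType) (alpha : W -> X -> R) (cls : Y -> Z -> W) (mass : W -> R).
Hypothesis cs : class_structure pZ alpha cls mass.

Definition class_rv (s : X * Y * Z) : W * Y := (cls s.1.2 s.2, s.1.2).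

Definition class_law (v : W) (y : Y) : R := (Sum x, pXY x y * alpha v x) * mass v.

Lemma pYZ_E y z : pYZ pXY pZ y z = (Sum x, pXY x y * alpha (cls y z) x) * gam y z.
Proof. by rewrite -sumRZr; apply: eq_sumR => x; rewrite (cs_fact cs); ring. Qed.

Lemma alpha_avg_pos v y : 0 < Sum x, pXY x y * alpha v x.
Proof.
have [a0 a1] := cs_pmf cs v.
have [x hx] : exists x, 0 < alpha v x by apply: sumR_gt0 => //; lra.
apply: Rlt_le_trans (sumR_ge1 (f := fun x => pXY x y * alpha v x) x _).
  exact: Rmult_lt_0_compat.
by move=> x'; apply: Rmult_le_pos => //; apply: Rlt_le.
Qed.

Lemma class_law_pos v y : 0 < class_law v y.
Proof. by apply: Rmult_lt_0_compat; [exact: alpha_avg_pos|exact: cs_pos cs v]. Qed.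

Lemma pr_class_rv v y : pr single class_rv (v, y) = class_law v y.
Proof.
rewrite /pr !sumR_pair /=.
transitivity (Sum x, Sum z, if cls y z == v then pXY x y * pZ x y z else 0).
  apply: eq_sumR => x; rewrite exch_sumR; apply: eq_sumR => z.
  rewrite -[RHS](sumR_delta y (fun y' => if cls y' z == v then pXY x y' * pZ x y' z else 0)).
  apply: eq_sumR => y'; rewrite /class_rv xpair_eqE /single /= andbC.
  by case: (y' == y).
rewrite /class_law -(cs_mass cs v y) -sumRZr; apply: eq_sumR => x.
rewrite -sumRZ; apply: eq_sumR => z; rewrite (cs_fact cs).
by case: eqP => [->|_]; ring.
Qed.

Lemma pr_Y y : pr single (fun s => s.1.2) y = pY pXY y.
Proof.
rewrite /pr !sumR_pair /=; apply: eq_sumR => x.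
rewrite -[RHS](sumR_delta y (fun y => pXY x y)); apply: eq_sumR => y'.
case: eqP => [->|_]; last exact: sumR0.
by rewrite /single /= sumRZ; case: (pZ_pmf x y) => _ ->; ring.
Qed.

Lemma class_mass_E y z : 0 < gam y z -> class_mass pXY pZ y z = class_law (cls y z) y.
Proof.
move=> h; rewrite /class_law -(cs_mass cs (cls y z) y) -sumRZ; apply: eq_sumR => z'.
rewrite pYZ_E.
have g0 := gam_ge0 pZ_pmf y z'.
(* Zero columns contribute 0 on both sides, whichever way the two tests fall. *)
case: (Rle_lt_or_eq_dec _ _ g0) => h'; last first.
  by rewrite -h'; case: excluded_middle_informative => a /=; case: ifP => _; ring.
case: excluded_middle_informative => [[a [a0 ha]]|n] /=.
  suff -> : cls y z' = cls y z by rewrite eqxx; ring.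
  apply: (cs_inj cs) => x.
  have e : (Sum x, pZ x y z') = a * gam y z by rewrite (eq_sumR ha) sumRZ.
  rewrite -/(gam y z') in e.
  apply: (Rmult_eq_reg_r (gam y z')); last lra.
  by rewrite -(cs_fact cs) ha (cs_fact cs) e; ring.
case: eqP => e; last ring.
case: n; exists (gam y z' / gam y z); split; first exact: div_gt0.
by move=> x; rewrite !(cs_fact cs) e; field; lra.
Qed.

Lemma pY_gt0 y : 0 < pY pXY y.
Proof.
have [x [_ _]] := XY_inhabited p_pos p_sum.
apply: Rlt_le_trans (p_pos x y) (sumR_ge1 (f := fun x => pXY x y) x _) => x'.
exact: Rlt_le.
Qed.

Lemma H_W_given_Y_E : H_W_given_Y pXY pZ * ln 2 =
  Hrv single class_rv - Hrv single (fun s => s.1.2).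
Proof.
transitivity (- Sum y, Sum z, pYZ pXY pZ y z * (ln (class_law (cls y z) y) - ln (pY pXY y))).
  rewrite /H_W_given_Y -sumRZr -sumRN; apply: eq_sumR => y.
  rewrite -sumRZr -sumRN; apply: eq_sumR => z.
  case: Req_EM_T => [e|n]; first by rewrite /= e; ring.
  have h : 0 < gam y z.
    case: (Rle_lt_or_eq_dec _ _ (gam_ge0 pZ_pmf y z)) => // h; case: n.
    by rewrite pYZ_E -h; ring.
  have -> : forall a b, - (a * b) * ln 2 = - (a * (b * ln 2)) by move=> *; ring.
  by rewrite log2_ln class_mass_E // ln_div //; [exact: class_law_pos|exact: pY_gt0].
rewrite !Hrv_E /Rminus Ropp_involutive.
have -> : forall a b, - a + b = - (a - b) by move=> *; ring.
rewrite -sumRB; congr (- _); rewrite !sumR_pair [RHS]exch_sumR; apply: eq_sumR => y.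
rewrite [RHS]exch_sumR; apply: eq_sumR => z; rewrite -sumRZr; apply: eq_sumR => x.
by rewrite /= pr_class_rv pr_Y /single /=; ring.
Qed.

End Indexed.
End Consistent.

(** * Converse: the rate bound *)

Section ConverseRate.
Variables (X Y Z : finType) (pXY : X -> Y -> R) (pZ : X -> Y -> Z -> R).
Hypothesis p_pos : forall x y, 0 < pXY x y.
Hypothesis p_sum : sumR (fun xy : (X * Y)%type => pXY xy.1 xy.2) = 1.
Hypothesis pZ_pmf : forall x y, is_pmf (pZ x y).
Variables (W : finType) (alpha : W -> X -> R) (cls : Y -> Z -> W) (mass : W -> R).
Hypothesis cs : class_structure pZ alpha cls mass.

Local Notation single := (single pXY pZ).
Local Notation class_rv := (class_rv (X := X) cls).

Lemma same_class_cls y z y' z' : same_class pZ y z y' z' -> cls y z = cls y' z'.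
Proof.
case=> h h' e; apply: (cs_inj cs) => x; have := e x; rewrite !(cs_fact cs) => ex.
have h2 : 0 < gam pZ y z * gam pZ y' z' by apply: Rmult_lt_0_compat.
apply: (Rmult_eq_reg_r (gam pZ y z * gam pZ y' z')); last lra.
by move: ex; rewrite -!Rmult_assoc => ->; ring.
Qed.

Lemma code_size_gt0 n m (c : code X Y Z n m) : valid_code c -> (0 < m)%N.
Proof.
case=> hc _; have [x [_ _]] := XY_inhabited p_pos p_sum.
have [p0 p1] := hc [ffun=> x].
have [i _] : exists i, 0 < enc c [ffun=> x] i by apply: sumR_gt0 => //; lra.
exact: leq_ltn_trans (leq0n i) (ltn_ord i).
Qed.

Lemma code_rate_bound n m (c : code X Y Z n m) : valid_code c ->
  Hrv (law pXY c) (fun w => mapn class_rv (xyz w)) -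
  Hrv (law pXY c) (fun w => mapn (fun s => s.1.2) (xyz w)) -
  (Sum i : 'I_n, Hrv (law pXY c) (fun w => (cls (w.2.1 i) (w.2.2 i), (w.1.1, w.2.1))) -
     Hrv (law pXY c) (fun w => (w.1.1, w.2.1))) <= ln (INR m).
Proof.
move=> cv; have l0 w : 0 <= law pXY c w by apply: law_ge0.
have k1 := Hrv_card l0 (fun w => w.1.1) (fun w => w.2.1) (sum_law p_sum cv) _.
rewrite card_ord in k1; have {}k1 := k1 (code_size_gt0 cv).
have k2 := Hrv_subadd l0
   (fun w : outcome X Y Z n m => [ffun i => cls (w.2.1 i) (w.2.2 i)] : seqn W n)
   (fun w => (w.1.1, w.2.1)).
have k3 : Hrv (law pXY c) (fun w => mapn class_rv (xyz w)) <=
  Hrv (law pXY c) (fun w => ([ffun i => cls (w.2.1 i) (w.2.2 i)] : seqn W n, (w.1.1, w.2.1))).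
  apply: Hrv_mono => // w w' [/ffunP e e1 e2].
  by apply/ffunP => i; have := e i; rewrite !ffunE /class_rv /= e2 => ->.
have k4 : Hrv (law pXY c) (fun w => mapn (fun s => s.1.2) (xyz w)) =
    Hrv (law pXY c) (fun w => w.2.1).
  apply: Hrv_equiv => w w'; apply/eqP/eqP => [/ffunP e|e]; last first.
    by apply/ffunP => j; rewrite !ffunE /= e.
  by apply/ffunP => j; have := e j; rewrite !ffunE.
have k5 : (Sum i : 'I_n, Hrv (law pXY c) (fun w =>
       (([ffun i => cls (w.2.1 i) (w.2.2 i)] : seqn W n) i, (w.1.1, w.2.1))) -
     Hrv (law pXY c) (fun w => (w.1.1, w.2.1))) =
   (Sum i : 'I_n, Hrv (law pXY c) (fun w => (cls (w.2.1 i) (w.2.2 i), (w.1.1, w.2.1))) -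
     Hrv (law pXY c) (fun w => (w.1.1, w.2.1))).
  apply: eq_sumR => i; congr (_ - _); apply: Hrv_equiv => w w'.
  by rewrite !ffunE.
rewrite k5 in k2; rewrite k4.
have lin a b p s q r : p - b <= r -> q - p <= s -> a <= q -> a - b - s <= r by lra.
exact: lin k1 k2 k3.
Qed.

Lemma converse_rate Rt : achievable pXY pZ Rt -> H_W_given_Y pXY pZ <= Rt.
Proof.
case=> msz [c [cP cA]].
apply: (Rmult_le_reg_r (ln 2)); first exact: ln2_gt0.
rewrite (H_W_given_Y_E p_pos p_sum pZ_pmf cs).
pose k := INR #|W|; pose c' := INR #|Y| * (INR #|Z| * INR #|Z|).
have k0 : 0 <= k by apply: pos_INR.
have c0 : 0 <= c' by do 2?apply: Rmult_le_pos; apply: pos_INR.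
(* 2 for the two continuity errors, k for |W| d <= |W| e, and 2 c' for the spread: with b = d e the
   factor 2/d of [letter_class_entropy] cancels. *)
apply: (@le_of_le_eps _ _ (2 + k + 2 * c')) => [|e e0]; first lra.
pose d := Rmin 1 e; have d0 : 0 < d by apply: Rmin_glb_lt; lra.
have d1 : d <= 1 := Rmin_l _ _; have de : d <= e := Rmin_r _ _.
have b0 : 0 < d * e by apply: Rmult_lt_0_compat.
have [e1 e10 [N1 h1]] := letters_bound p_pos p_sum pZ_pmf b0.
have [e2 e20 [N2 h2]] := code_continuity p_pos p_sum pZ_pmf class_rv e0.
have [e3 e30 [N3 h3]] := code_continuity p_pos p_sum pZ_pmf (fun s => s.1.2) e0.
pose eps := Rmin e1 (Rmin e2 e3).
have eps0 : 0 < eps by do 2?apply: Rmin_glb_lt.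
have m1 : eps <= e1 := Rmin_l _ _.
have m2 : eps <= e2 := Rle_trans _ _ _ (Rmin_r _ _) (Rmin_l _ _).
have m3 : eps <= e3 := Rle_trans _ _ _ (Rmin_r _ _) (Rmin_r _ _).
have [N4 h4] := cA eps eps0.
pose n := maxn 1 (maxn N1 (maxn N2 (maxn N3 N4))).
have [n0 [n1 [n2 [n3 n4]]]] :
  (1 <= n)%N /\ (N1 <= n)%N /\ (N2 <= n)%N /\ (N3 <= n)%N /\ (N4 <= n)%N.
  by rewrite /n !leq_max !leqnn !orbT.
have [tv lk] := h4 n n4; have [sz cv] := cP n.
have nn : 0 < INR n by apply/lt_0_INR/ltP.
have lk' : leak pXY (c n) <= INR n * e1 by apply: Rle_trans lk _; apply: Rmult_le_compat_l; lra.
have [bi [bi0 hbi hs]] := h1 n n1 _ _ cv (Rle_trans _ _ _ tv m1) lk'.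
have [/Rabs_def2_le k2 _] := h2 n n2 _ _ cv (Rle_trans _ _ _ tv m2).
have [/Rabs_def2_le k3 _] := h3 n n3 _ _ cv (Rle_trans _ _ _ tv m3).
have kr := code_rate_bound cv.
have ks : (Sum i : 'I_n, Hrv (law pXY (c n)) (fun w => (cls (w.2.1 i) (w.2.2 i), (w.1.1, w.2.1))) -
     Hrv (law pXY (c n)) (fun w => (w.1.1, w.2.1))) <= INR n * (k * e + 2 * c' * e).
  apply: Rle_trans (_ : (Sum i : 'I_n, k * d + 2 / d * c' * bi i) <= _).
    apply: sumR_le => i.
    have -> : k * d + 2 / d * c' * bi i =
      k * d + 2 / d * (INR #|Y| * (INR #|Z| * (INR #|Z| * bi i))) by rewrite /c'; ring.
    apply: (letter_class_entropy p_pos p_sum cv) => // y z z' nc.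
    have [_ h] := hs i y z; apply: h => /same_class_cls e'.
    by move: nc; rewrite e' eqxx.
  rewrite sumRD sumR_ord_const sumRZ.
  have i1 : 2 / d * c' * sumR bi <= 2 / d * c' * (INR n * (d * e)).
    apply: Rmult_le_compat_l => //; apply: Rmult_le_pos => //; apply: div_ge0; lra.
  have i2 : 2 / d * c' * (INR n * (d * e)) = INR n * (2 * c' * e) by field; lra.
  have i3 : INR n * (k * d) <= INR n * (k * e).
    by apply: Rmult_le_compat_l; [lra|apply: Rmult_le_compat_l].
  lra.
have m0 : 0 < INR (msz n) by apply/lt_0_INR/ltP/(code_size_gt0 cv).
have ksz : ln (INR (msz n)) <= INR n * Rt * ln 2.
  by have := ln_le_ m0 sz; rewrite /Rpower ln_exp.
apply: (Rmult_le_reg_l (INR n)) => //.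
have lin (nn' a b a' b' s l r ee kk cc : R) : - (nn' * ee) <= a - nn' * a' <= nn' * ee ->
  - (nn' * ee) <= b - nn' * b' <= nn' * ee -> a - b - s <= l ->
  s <= nn' * (kk * ee + 2 * cc * ee) ->
  l <= nn' * r * ln 2 -> nn' * (a' - b') <= nn' * (r * ln 2 + (2 + kk + 2 * cc) * ee) by lra.
exact: lin k2 k3 kr ks ksz.
Qed.

End ConverseRate.

(** * Achievability: random binning of the classes *)

(** Where P(a,b,c) is nonzero, P(a,b,c) = P(b,c) and P(a,c) = P(c), so each logarithm has argument
    1. *)
Lemma cmi_det (A B C : finType) (Q : A -> B -> C -> R) (F : C -> A) :
  (forall a b c, 0 <= Q a b c) -> (forall a b c, Q a b c <> 0 -> a = F c) -> cmi Q = 0.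
Proof.
move=> Q0 h; apply: sumR0 => a; apply: sumR0 => b; apply: sumR0 => c.
case: Req_EM_T => //= n; have e := h _ _ _ n.
have only a' b' : Q a' b' c = if a' == F c then Q (F c) b' c else 0.
  case: eqP => [-> //|ne]; case: (Req_dec (Q a' b' c) 0) => // n'.
  by case: ne; apply: h n'.
have -> : (Sum a, Q a b c) = Q a b c.
  by rewrite (eq_sumR (fun a => only a b)) (sumR_delta (F c) (fun=> Q (F c) b c)) e.
have -> : (Sum a, Sum b, Q a b c) = Sum b, Q a b c.
  rewrite exch_sumR; apply: eq_sumR => b'.
  by rewrite (eq_sumR (fun a => only a b')) (sumR_delta (F c) (fun=> Q (F c) b' c)) e.
have n' := sumR_ge1 b (fun b => Q0 a b c); have q0 := Q0 a b c.
have -> : Q a b c * (Sum b, Q a b c) / ((Sum b, Q a b c) * Q a b c) = 1 by field; lra.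
by rewrite /log2 ln_1; field; have := ln2_gt0; lra.
Qed.

Lemma nat_floor t : 0 <= t -> exists m : nat, INR m <= t < INR m + 1.
Proof.
move=> t0; have [u1 u2] := archimed t.
have h : (0 < up t)%Z by apply: lt_IZR; lra.
exists (Z.to_nat (up t - 1)); rewrite INR_IZR_INZ Z2Nat.id ?minus_IZR; [lra|lia].
Qed.

Lemma exists_le_avg (T : finType) (F : T -> R) b : (0 < #|T|)%N ->
  sumR F <= INR #|T| * b -> exists t, F t <= b.
Proof.
move=> /card_gt0P [t0 _] h; apply: NNPP => n.
have lt t : 0 < F t - b.
  by have : ~ (F t <= b) by [move=> k; apply: n; exists t]; lra.
have := sumR_ge1 t0 (fun t => Rlt_le _ _ (lt t)).
by rewrite sumRB sumR_const; have := lt t0; lra.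
Qed.

(** Redrawing f uniformly at w' preserves the uniform law of f and hits f w with probability 1/m. *)
Lemma sum_collision (T : finType) m (w w' : T) : w' != w ->
  (Sum f : {ffun T -> 'I_m}, if f w' == f w then 1 else 0) * INR m = INR #|{ffun T -> 'I_m}|.
Proof.
move=> nw; case: m => [|m].
  have e : #|{ffun T -> 'I_0}| = 0%N.
    rewrite card_ffun card_ord; apply: exp0n; apply/card_gt0P; by exists w.
  by rewrite e /=; ring.
have m0 : 0 < INR m.+1 by apply/lt_0_INR/ltP.
have r1 : (Sum _ : 'I_m.+1, / INR m.+1) = 1 by rewrite sumR_ord_const Rinv_r; lra.
rewrite -(sum_upd w' _ r1).
transitivity ((Sum f : {ffun T -> 'I_m.+1}, / INR m.+1) * INR m.+1); last first.
  by rewrite sumR_const Rmult_assoc Rinv_l ?Rmult_1_r //; lra.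
congr (_ * _); apply: eq_sumR => f.
rewrite sumRZ (eq_sumR (g := fun a => if a == f w then 1 else 0)).
  by rewrite (sumR_delta (f w) (fun=> 1)); ring.
by move=> a; rewrite !updE eqxx (eq_sym w w') (negbTE nw).
Qed.

Lemma zip2_bij (A B : finType) n : bijective
  (fun t : seqn B n * seqn A n => [ffun i => (t.2 i, t.1 i)] : seqn (A * B)%type n).
Proof.
exists (fun s : seqn (A * B)%type n =>
  ([ffun i => (s i).2] : seqn B n, [ffun i => (s i).1] : seqn A n)) => [[y x]|s].
  by congr (_, _); apply/ffunP => i; rewrite !ffunE.
by apply/ffunP => i; rewrite ffunE /= !ffunE; case: (s i).
Qed.

Section Achievability.
Variables (X Y Z : finType) (pXY : X -> Y -> R) (pZ : X -> Y -> Z -> R).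
Hypothesis p_pos : forall x y, 0 < pXY x y.
Hypothesis p_sum : sumR (fun xy : (X * Y)%type => pXY xy.1 xy.2) = 1.
Hypothesis pZ_pmf : forall x y, is_pmf (pZ x y).
Variables (W : finType) (alpha : W -> X -> R) (cls : Y -> Z -> W) (mass : W -> R).
Hypothesis cs : class_structure pZ alpha cls mass.

Local Notation single := (single pXY pZ).
Local Notation class_rv := (class_rv (X := X) cls).
Local Notation gam := (gam pZ).
Local Notation class_law := (class_law pXY alpha mass).

(** P(W = v | X = x), the channel that does not look at y; [resample] is P(Z = z | W = v, Y = y). *)
Definition chan (x : X) (v : W) : R := alpha v x * mass v.
Definition resample (v : W) (y : Y) (z : Z) : R := (if cls y z == v then gam y z else 0) / mass v.

Lemma chan_ge0 x v : 0 <= chan x v.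
Proof. by apply: Rmult_le_pos; [case: (cs_pmf cs v)|exact: Rlt_le (cs_pos cs v)]. Qed.

Lemma resample_ge0 v y z : 0 <= resample v y z.
Proof.
apply: div_ge0; last exact: Rlt_le (cs_pos cs v).
by case: ifP => _; [exact: gam_ge0|lra].
Qed.

Lemma sum_resample v y : (Sum z, resample v y z) = 1.
Proof.
by rewrite /Rdiv sumRZr (cs_mass cs) Rinv_r //; have := cs_pos cs v; lra.
Qed.

Lemma pZ_split x y z : pZ x y z = Sum v, chan x v * resample v y z.
Proof.
rewrite -(sumR_delta' (cls y z) (fun v => pZ x y z)); apply: eq_sumR => v.
rewrite /chan /resample; have := cs_pos cs v => m0.
case: eqP => [e|_]; last by rewrite /Rdiv; ring.
by rewrite (cs_fact cs) e; field; lra.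
Qed.

(** Sum [pZ_split] over z at any one y: the normalisation is inherited from [pZ]. *)
Lemma sum_chan x : (Sum v, chan x v) = 1.
Proof.
have [_ [y _]] := XY_inhabited p_pos p_sum.
have [_ <-] := pZ_pmf x y.
rewrite (eq_sumR (pZ_split x y)) exch_sumR; apply: eq_sumR => v.
by rewrite sumRZ sum_resample; ring.
Qed.

Lemma class_law_chan v y : (Sum x, pXY x y * chan x v) = class_law v y.
Proof.
transitivity ((Sum x, pXY x y * alpha v x) * mass v) => //.
by rewrite -sumRZr; apply: eq_sumR => x; rewrite /chan; ring. Qed.

Lemma sum_class_law : sumR (fun t : W * Y => class_law t.1 t.2) = 1.
Proof.
rewrite -(sum_single p_sum pZ_pmf) -(sum_pr1 _ class_rv); apply: eq_sumR => -[v y].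
by rewrite (pr_class_rv _ cs).
Qed.

Lemma sum_class_law_Y y : (Sum v, class_law v y) = pY pXY y.
Proof.
under eq_sumR => v do rewrite -class_law_chan.
by rewrite exch_sumR; apply: eq_sumR => x; rewrite sumRZ sum_chan; ring.
Qed.

Definition surprisal (t : W * Y) : R := ln (pY pXY t.2) - ln (class_law t.1 t.2).

Lemma mean_surprisal :
  (Sum t : W * Y, class_law t.1 t.2 * surprisal t) = H_W_given_Y pXY pZ * ln 2.
Proof.
rewrite (H_W_given_Y_E p_pos p_sum pZ_pmf cs).
have -> : Hrv single (fun s => s.1.2) = - Sum t : W * Y, class_law t.1 t.2 * ln (pY pXY t.2).
  rewrite Hrv_E; congr (- _).
  transitivity (Sum t, pr single class_rv t * ln (pY pXY t.2)).
    by rewrite (sum_pr _ _ (fun t => ln (pY pXY t.2))); apply: eq_sumR => s; rewrite pr_Y.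
  by apply: eq_sumR => -[v y]; rewrite (pr_class_rv _ cs).
have -> : Hrv single class_rv = - Sum t : W * Y, class_law t.1 t.2 * ln (class_law t.1 t.2).
  by rewrite -sumRN; apply: eq_sumR => -[v y]; rewrite (pr_class_rv _ cs).
rewrite /Rminus Ropp_involutive Rplus_comm -sumRN -sumRD; apply: eq_sumR => t.
by rewrite /surprisal; ring.
Qed.

(** * The code of a fixed binning function *)

Section BinningCode.
Variables (n m : nat) (f : seqn W n -> 'I_m) (typ : seqn Y n -> pred (seqn W n)) (v0 : W).

(** The second choice keeps the decoder inside the announced bin even if no typical word lies there;
    hence the leakage is exactly 0. [v0] is the default for empty bins, which are never
    announced. *)
Definition bin_decode (k : 'I_m) (y : seqn Y n) : seqn W n :=
  if [pick w | (f w == k) && typ y w] is Some w then w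
  else if [pick w | f w == k] is Some w then w else [ffun=> v0].

Definition chann (x : seqn X n) (w : seqn W n) : R := prodn (fun i => chan (x i) (w i)).
Definition resamplen (w : seqn W n) (y : seqn Y n) (z : seqn Z n) : R :=
  prodn (fun i => resample (w i) (y i) (z i)).

Definition bin_code : code X Y Z n m :=
  Code (fun x => pr (chann x) f) (fun k y => resamplen (bin_decode k y) y).

Lemma chann_ge0 x w : 0 <= chann x w.
Proof. by apply: prodn_ge0 => i; apply: chan_ge0. Qed.

Lemma resamplen_ge0 w y z : 0 <= resamplen w y z.
Proof. by apply: prodn_ge0 => i; apply: resample_ge0. Qed.

Lemma sum_chann x : sumR (chann x) = 1.
Proof.
rewrite -(prodn_sum (fun i => chan (x i))) (eq_prodn (g := fun=> 1)) ?prodn1 // => i.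
exact: sum_chan.
Qed.

Lemma sum_resamplen w y : sumR (resamplen w y) = 1.
Proof.
rewrite -(prodn_sum (fun i => resample (w i) (y i))) (eq_prodn (g := fun=> 1)) ?prodn1 // => i.
exact: sum_resample.
Qed.

Lemma bin_code_valid : valid_code bin_code.
Proof.
split=> [x|k y]; split.
- by apply: pr_ge0; apply: chann_ge0.
- by rewrite sum_pr1 sum_chann.
- exact: resamplen_ge0.
- exact: sum_resamplen.
Qed.

Lemma bin_decodeK w y : f (bin_decode (f w) y) = f w.
Proof.
rewrite /bin_decode; case: pickP => [w' /andP [/eqP]//|_].
by case: pickP => [w' /eqP //|/(_ w)]; rewrite eqxx.
Qed.

Lemma bin_code_leak : leak pXY bin_code = 0.
Proof.
apply: (cmi_det (F := fun yz : seqn Y n * seqn Z n => f [ffun i => cls (yz.1 i) (yz.2 i)])).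
  move=> k x [y z]; do 2?apply: Rmult_le_pos; last exact: resamplen_ge0.
    by apply: prodn_ge0 => i; apply: Rlt_le.
  by apply: pr_ge0; apply: chann_ge0.
move=> k x [y z]; rewrite /joint /= => ne.
have ne1 : pr (chann x) f k <> 0 by move=> e; apply: ne; rewrite e; ring.
have ne2 : resamplen (bin_decode k y) y z <> 0 by move=> e; apply: ne; rewrite e; ring.
have [w e _] : exists2 w, f w = k & 0 < chann x w.
  apply: pr_pos_ex; first exact: chann_ge0.
  by have := pr_ge0 (chann_ge0 x) f k; lra.
(* A nonzero [resample] factor forces the class of each output letter to be the decoded one. *)
rewrite -e -{1}(bin_decodeK w y) e; congr f; apply/ffunP => i; rewrite ffunE.
case: (eqVneq (cls (y i) (z i)) (bin_decode k y i)) => // h; case: ne2.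
by apply: (prodn_eq0 (i := i)); rewrite /resample (negbTE h) /Rdiv; ring.
Qed.

Definition pWYn (w : seqn W n) (y : seqn Y n) : R := prodn (fun i => class_law (w i) (y i)).

Lemma pWYn_E w y : (Sum x, pXYn pXY x y * chann x w) = pWYn w y.
Proof.
rewrite /pWYn -(eq_prodn (fun i => class_law_chan (w i) (y i))).
rewrite (prodn_sum (fun i x => pXY x (y i) * chan x (w i))).
by apply: eq_sumR => x; rewrite prodnM.
Qed.

(** Couples the code with the target through the same class word w: correct decoding gives identical
    resampling, and a wrong one costs L1 weight at most 2, offset by the 1/2 of the distance. *)
Lemma bin_code_tv : tv_dist pXY pZ bin_code <=
  Sum y, Sum w, if bin_decode (f w) y == w then 0 else pWYn w y.
Proof.
pose G x y w := if bin_decode (f w) y == w then 0 else pXYn pXY x y * chann x w.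
have p0 x y : 0 <= pXYn pXY x y by apply: prodn_ge0 => i; apply: Rlt_le.
have -> : (Sum y, Sum w, if bin_decode (f w) y == w then 0 else pWYn w y) =
    Sum x, Sum y, Sum w, G x y w.
  rewrite [RHS]exch_sumR; apply: eq_sumR => y; rewrite [RHS]exch_sumR; apply: eq_sumR => w.
  by rewrite /G -pWYn_E; case: eqP => // _; rewrite sumR0.
rewrite /tv_dist -[X in _ <= X]Rmult_1_l -(Rinv_l 2) ?Rmult_assoc; last lra.
apply: Rmult_le_compat_l; first lra.
rewrite -sumRZ; apply: sumR_le => x; rewrite -sumRZ; apply: sumR_le => y.
have joint_E z : joint_XYZ pXY bin_code x y z =
    Sum w, pXYn pXY x y * chann x w * resamplen (bin_decode (f w) y) y z.
  rewrite /joint_XYZ /joint /=.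
  transitivity (Sum k, pr (chann x) f k * (pXYn pXY x y * resamplen (bin_decode k y) y z)).
    by apply: eq_sumR => k; ring.
  rewrite (sum_pr _ _ (fun k => pXYn pXY x y * resamplen (bin_decode k y) y z)).
  by apply: eq_sumR => w; ring.
have ideal_E z : pXYZn pXY pZ x y z = Sum w, pXYn pXY x y * chann x w * resamplen w y z.
  rewrite /pXYZn prodnM (eq_prodn (fun i => pZ_split (x i) (y i) (z i))) prodn_sum -sumRZ.
  by apply: eq_sumR => w; rewrite prodnM -Rmult_assoc.
apply: Rle_trans (_ : (Sum z, Sum w, G x y w *
   (resamplen (bin_decode (f w) y) y z + resamplen w y z)) <= _).
  apply: sumR_le => z; rewrite joint_E ideal_E -sumRB; apply: Rle_trans (sumR_abs _) _.
  apply: sumR_le => w; rewrite /G; case: eqP => [->|_]; first by rewrite Rminus_diag Rabs_R0; lra.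
  have h : 0 <= pXYn pXY x y * chann x w by apply: Rmult_le_pos => //; apply: chann_ge0.
  have r1 := resamplen_ge0 (bin_decode (f w) y) y z; have r2 := resamplen_ge0 w y z.
  rewrite -Rmult_minus_distr_l Rabs_mult (Rabs_pos_eq _ h).
  by apply: Rmult_le_compat_l => //; apply: Rabs_le; lra.
rewrite exch_sumR -sumRZ; apply: Req_le; apply: eq_sumR => w.
by rewrite sumRZ sumRD !sum_resamplen; ring.
Qed.

End BinningCode.

(** * Random choice of the binning function *)

Section RandomBinning.
Variables (n m : nat) (d : R) (v0 : W).
Hypotheses (m_gt0 : (0 < m)%N) (d_gt0 : 0 < d).

Let h := H_W_given_Y pXY pZ * ln 2.

Definition atypical (y : seqn Y n) (w : seqn W n) : bool :=
  if Rlt_dec (INR n * (h + d)) (Sum i, surprisal (w i, y i)) then true else false.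

Let typ y w := ~~ atypical y w.

Let p_gt0 v y : 0 < class_law v y. Proof. exact: class_law_pos cs v y. Qed.

(** Given y, each typical word has conditional probability at least exp (- n (h + d)), and these
    probabilities sum to at most 1. *)
Lemma typical_count y : (Sum w, if typ y w then 1 else 0) <= exp (INR n * (h + d)).
Proof.
pose c w := prodn (fun i => class_law (w i) (y i) / pY pXY (y i)).
have pY0 b : 0 < pY pXY b by apply: (pY_gt0 p_pos p_sum).
have c0 (w : seqn W n) : 0 < c w by apply: prodn_gt0 => i; apply: div_gt0.
have c1 : (Sum w : seqn W n, c w) = 1.
  rewrite -(prodn_sum (fun i v => class_law v (y i) / pY pXY (y i))).
  rewrite (eq_prodn (g := fun=> 1)) ?prodn1 // => i.
  by rewrite /Rdiv sumRZr sum_class_law_Y Rinv_r //; have := pY0 (y i); lra.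
rewrite -[X in _ <= X]Rmult_1_r -[X in _ <= _ * X]c1 -sumRZ; apply: sumR_le => w.
rewrite /typ /atypical; case: Rlt_dec => /= k.
  by apply: Rmult_le_pos; [exact/Rlt_le/exp_pos|exact: Rlt_le].
have -> : c w = exp (- Sum i, surprisal (w i, y i)).
  rewrite -(exp_ln (c w)) // ln_prodn; last by move=> i; apply: div_gt0.
  rewrite -sumRN; congr exp; apply: eq_sumR => i; rewrite ln_div // /surprisal /=; ring.
rewrite -exp_plus -exp_0; case: (Rnot_lt_le _ _ k) => [k'|->].
  by apply/Rlt_le/exp_increasing; apply: (proj2 (Rlt_0_minus _ _) k').
by rewrite Rplus_opp_r; exact: Rle_refl.
Qed.

(** Pointwise union bound: an error requires that w be atypical or that another typical word share
    its bin. *)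
Lemma decode_err_le (f : {ffun seqn W n -> 'I_m}) y w :
  (if bin_decode f typ v0 (f w) y == w then 0 else 1) <=
  (if atypical y w then 1 else 0) +
  Sum w', if (w' != w) && typ y w' then (if f w' == f w then 1 else 0) else 0.
Proof.
have s0 w' : 0 <= if (w' != w) && typ y w' then (if f w' == f w then 1 else 0) else 0.
  by do 2?case: ifP => _; lra.
case: (boolP (atypical y w)) => [_|aw].
  apply: Rle_trans (_ : 1 + 0 <= _); first by case: ifP => _; lra.
  by apply: Rplus_le_compat_l; apply: sumR_ge0.
rewrite Rplus_0_l; case: eqP => [_|]; first exact: sumR_ge0.
rewrite /bin_decode.
case: pickP => [w' /andP [/eqP e t] /eqP ne|/(_ w)]; last by rewrite eqxx /typ aw.
by apply: Rle_trans (sumR_ge1 w' s0); rewrite ne t e eqxx /=; exact: Rle_refl.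
Qed.

(** Average over all f: a competing typical word collides with probability 1/m, and [typical_count]
    bounds the number of competitors. *)
Lemma exists_good_binning : exists f : {ffun seqn W n -> 'I_m},
  (Sum y, Sum w, if bin_decode f typ v0 (f w) y == w then 0 else pWYn w y) <=
  (Sum y, Sum w, if atypical y w then pWYn w y else 0) + exp (INR n * (h + d)) / INR m.
Proof.
have m0 : 0 < INR m by apply/lt_0_INR/ltP.
have w0 (w : seqn W n) y : 0 <= pWYn w y by apply/Rlt_le/prodn_gt0 => i.
have w1 : (Sum y : seqn Y n, Sum w : seqn W n, pWYn w y) = 1.
  under eq_sumR => y do rewrite -(prodn_sum (fun i v => class_law v (y i))).
  rewrite -(prodn_sum (fun _ b => Sum v, class_law v b)) (eq_prodn (g := fun=> 1)) ?prodn1 // => i.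
  by rewrite -sum_class_law sumR_pair exch_sumR.
apply: exists_le_avg.
  by rewrite card_ffun card_ord expn_gt0 m_gt0.
set F := INR #|_|; have F0 : 0 <= F by apply: pos_INR.
set At := (X in F * (X + _)).
apply: Rle_trans (_ : (Sum f : {ffun seqn W n -> 'I_m}, Sum y, Sum w, pWYn w y *
   ((if atypical y w then 1 else 0) +
    Sum w', if (w' != w) && typ y w' then (if f w' == f w then 1 else 0) else 0)) <= _).
  apply: sumR_le => f; apply: sumR_le => y; apply: sumR_le => w.
  have k := Rmult_le_compat_l _ _ _ (w0 w y) (decode_err_le f y w).
  by apply: Rle_trans k; case: ifP => _; lra.
rewrite exch_sumR.
apply: Rle_trans (_ : (Sum y, Sum w, F * (if atypical y w then pWYn w y else 0) +
    pWYn w y * (F * (exp (INR n * (h + d)) / INR m))) <= _); last first.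
  rewrite [X in _ <= X]Rmult_plus_distr_l.
  have -> : F * At = Sum y, Sum w, F * (if atypical y w then pWYn w y else 0).
    by rewrite -sumRZ; apply: eq_sumR => y; rewrite sumRZ.
  rewrite -[X in _ <= _ + X]Rmult_1_l -w1 -sumRZr -sumRD; apply: Req_le; apply: eq_sumR => y.
  by rewrite -sumRZr -sumRD.
apply: sumR_le => y; rewrite exch_sumR; apply: sumR_le => w.
rewrite sumRZ sumRD sumR_const -/F exch_sumR.
have -> : F * (if atypical y w then pWYn w y else 0) =
   pWYn w y * (F * (if atypical y w then 1 else 0)).
  by case: ifP => _; ring.
rewrite -Rmult_plus_distr_l; apply: Rmult_le_compat_l => //; apply: Rplus_le_compat_l.
apply: Rle_trans (_ : (Sum w', F / INR m * (if typ y w' then 1 else 0)) <= _); last first.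
  rewrite sumRZ; have := typical_count y => k.
  have : F / INR m * (Sum w, if typ y w then 1 else 0) <= F / INR m * exp (INR n * (h + d)).
    by apply: Rmult_le_compat_l => //; apply: div_ge0; lra.
  by rewrite /Rdiv; lra.
apply: sumR_le => w'; have Fm : 0 <= F / INR m by apply: div_ge0; lra.
case: (eqVneq w' w) => [_|nw] /=.
  by rewrite sumR0 //; case: ifP => _; lra.
case: ifP => _; last by rewrite sumR0 //; lra.
rewrite Rmult_1_r; apply: (Rmult_le_reg_r (INR m)) => //.
have -> : F / INR m * INR m = F by field; lra.
by apply: Req_le; apply: sum_collision.
Qed.

Lemma atypical_le : (0 < n)%N ->
  (Sum y, Sum w, if atypical y w then pWYn w y else 0) <=
  (Sum t : W * Y, class_law t.1 t.2 * (surprisal t - h) ^ 2) / (INR n * d ^ 2).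
Proof.
move=> n0.
have k := @chebyshev _ n (fun t : W * Y => class_law t.1 t.2) sum_class_law _ surprisal d n0 d_gt0.
rewrite mean_surprisal -/h in k.
apply: Rle_trans (k (fun t => Rlt_le _ _ (p_gt0 t.1 t.2))); apply: Req_le.
rewrite -(reindex_sumR _ (zip2_bij W Y n)) sumR_pair; apply: eq_sumR => y; apply: eq_sumR => w.
rewrite /atypical.
rewrite (eq_sumR (g := fun i => surprisal (([ffun i => (w i, y i)] : seqn (W * Y)%type n) i))).
  case: Rlt_dec => //= _; apply: eq_prodn => i; by rewrite ffunE.
by move=> i; rewrite ffunE.
Qed.

End RandomBinning.

Lemma achievable_above Rt : H_W_given_Y pXY pZ < Rt -> achievable pXY pZ Rt.
Proof.
move=> hR; set h := H_W_given_Y pXY pZ * ln 2.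
have l2 := ln2_gt0.
(* Half the gap in nats, so that n Rt ln 2 = n (h + d) + n d: one [d] for the typical set, one for
   the bins to outnumber it. *)
pose d := (Rt * ln 2 - h) / 2.
have d0 : 0 < d.
  have : 0 < (Rt - H_W_given_Y pXY pZ) * ln 2 by apply: Rmult_lt_0_compat; lra.
  by rewrite /d /h; lra.
have h0 : 0 <= h.
  rewrite /h (H_W_given_Y_E p_pos p_sum pZ_pmf cs).
  have := @Hrv_mono _ single (single_ge0 p_pos pZ_pmf) _ _ (fun s => s.1.2) class_rv.
  by move=> /(_ ltac:(by move=> w w' [])); lra.
have [v0 _] : exists v0 : W, True.
  have [x [_ _]] := XY_inhabited p_pos p_sum.
  by have [v _] := @sumR_gt0 _ _ (chan_ge0 x) ltac:(rewrite sum_chan; lra); exists v.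
pose V := (Sum t : W * Y, class_law t.1 t.2 * (surprisal t - h) ^ 2).
have V0 : 0 <= V.
  apply: sumR_ge0 => t; apply: Rmult_le_pos; last exact: pow2_ge_0.
  exact/Rlt_le/(class_law_pos p_pos cs).
(* Size and code are packed together so that one choice per n selects both. *)
pose Q n (mc : {m : nat & code X Y Z n m}) := let c := projT2 mc in
  [/\ INR (projT1 mc) <= Rpower 2 (INR n * Rt), valid_code c, leak pXY c = 0 &
   (0 < n)%N -> tv_dist pXY pZ c <= V / (INR n * d ^ 2) + 2 / (INR n * d)].
have ex n : exists mc, Q n mc.
  pose t := Rpower 2 (INR n * Rt).
  have tE : t = exp (INR n * (h + d) + INR n * d).
    by rewrite /t /Rpower; congr exp; rewrite /d; field.
  have t1 : 1 <= t.
    rewrite -exp_0 tE; have n0 := pos_INR n.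
    have : 0 <= INR n * (h + d) + INR n * d by 
      by apply: Rplus_le_le_0_compat; apply: Rmult_le_pos; lra.
    by case=> [k|<-]; [exact/Rlt_le/exp_increasing|exact: Rle_refl].
  have [m [m1 m2]] := nat_floor (Rle_trans _ _ _ Rle_0_1 t1).
  have m0 : (0 < m)%N by case: (m) m2 => //= ?; lra.
  have mr : 1 <= INR m by rewrite -INR_1; apply/le_INR/leP.
  have [f hf] := @exists_good_binning n m d v0 m0.
  exists (existT _ m (bin_code f (fun y w => ~~ atypical d y w) v0)); split => //=.
  - exact: bin_code_valid.
  - exact: bin_code_leak.
  move=> n0; apply: Rle_trans (bin_code_tv _ _ _) _; apply: Rle_trans hf _.
  apply: Rplus_le_compat; first exact: atypical_le.
  have nn : 0 < INR n by apply/lt_0_INR/ltP.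
  have nd : 0 < INR n * d by apply: Rmult_lt_0_compat.
  (* exp (n d) >= n d gives the collision term the same order 1/n as the Chebyshev term; the 2 pays
     for rounding down the number of bins, t < m + 1 <= 2 m. *)
  have tm : exp (INR n * (h + d)) * (INR n * d) <= 2 * INR m.
    apply: Rle_trans (_ : t <= _); last lra.
    rewrite tE exp_plus; apply: Rmult_le_compat_l; first exact/Rlt_le/exp_pos.
    by have := exp_ineq1_le (INR n * d); lra.
  apply: (Rmult_le_reg_r (INR m * (INR n * d))); first by apply: Rmult_lt_0_compat; lra.
  rewrite -/h; apply: Rle_trans (_ : exp (INR n * (h + d)) * (INR n * d) <= _).
    by apply: Req_le; field; lra.
  by apply: Rle_trans tm _; apply: Req_le; field; lra.
pose mc n := proj1_sig (constructive_indefinite_description _ (ex n)).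
have mcP n : Q n (mc n) by rewrite /mc; case: constructive_indefinite_description.
exists (fun n => projT1 (mc n)), (fun n => projT2 (mc n)); split=> [n|eps e0].
  by have [h1 h2 _ _] := mcP n.
pose B := V / d ^ 2 + 2 / d.
have B0 : 0 <= B.
  by apply: Rplus_le_le_0_compat; apply: div_ge0; try lra; apply: pow_le; lra.
have [N hN] := INR_archimed eps (B + 1) e0.
exists (maxn N 1) => n; rewrite geq_max => /andP [Nn n1].
have n0 : 0 < INR n by apply/lt_0_INR/ltP.
have [_ _ -> tv] := mcP n; split; last by apply: Rmult_le_pos; lra.
apply: Rle_trans (tv n1) _; apply: (Rmult_le_reg_r (INR n)) => //.
have -> : (V / (INR n * d ^ 2) + 2 / (INR n * d)) * INR n = B by rewrite /B; field; lra.
have := le_INR _ _ (leP Nn) => NN.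
have : INR N * eps <= INR n * eps by apply: Rmult_le_compat_r; lra.
lra.
Qed.

End Achievability.

Theorem theorem4 (X Y Z : finType) (pXY : X -> Y -> R) (pZ : X -> Y -> Z -> R)
  (HpXY : is_pmf (fun xy : (X * Y)%type => pXY xy.1 xy.2))
  (Hfull : forall x y, 0 < pXY x y)
  (HpZ : forall x y, is_pmf (pZ x y))
  (Hsec : exists Rt, achievable pXY pZ Rt) :
  consistent_classes pZ /\ is_inf (achievable pXY pZ) (H_W_given_Y pXY pZ).
Proof.
have p_sum := proj2 HpXY; have [Rt0 hRt0] := Hsec.
have [k [alpha [cls [mass cs]]]] :=
  class_structure_exists Hfull p_sum HpZ (class_weight_const Hfull p_sum HpZ hRt0).
split; first exact: consistent_of_structure cs.
split=> [Rt|r lower]; first exact: (converse_rate Hfull p_sum HpZ cs).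
apply: Rnot_lt_le => hr.
have := lower _ (achievable_above Hfull p_sum HpZ cs
  (Rt := (H_W_given_Y pXY pZ + r) / 2) ltac:(lra)).
lra.
Qed.
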